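(* Let $(M,c)$ be a Riemannian conformal structure on a manifold $M$ of dimension $n\ge 2$, let $D$ be a Möbius structure for $(M,c)$, and fix $g\in c$. Let $\widehat D(g)$ be the endomorphism field defined by $D(g)(V,W)=g(\widehat D(g)(V),W)$ for $V,W\in\mathfrak{X}(M)$, and put $\alpha(\rho)=\mathrm{Id}+2\rho\,\widehat D(g)$ for $\rho\in\mathbb{R}$. Then for every $x\in M$ there is an open neighbourhood $\mathcal{O}\subset M$ of $x$ such that $\alpha$ restricts to an admissible smooth $1$-parameter family on $\mathcal{O}$, and the Möbius structure for $(\mathcal{O},c|_{\mathcal{O}})$ obtained by restricting $D$ to $\mathcal O$ equals the assignment $$e^{2u}g|_{\mathcal{O}}\mapsto e^{2u}g\big(A_{\eta^u}(-),-\big),\qquad u\in C^\infty(\mathcal{O}),$$ where $A_{\eta^u}$ is the Weingarten endomorphism of the lightlike normal field $\eta^u$ along the immersion $\Psi^u\colon\mathcal{O}\to(\widetilde{\mathcal{O}},\widetilde g)$ associated with $g|_{\mathcal{O}}$ and $\alpha$. If $M$ is compact, the same holds globally, i.e. with $\mathcal{O}=M$.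
   Context: Manifolds are smooth, Hausdorff, second countable, without boundary. A Riemannian conformal structure $(M,c)$ is an equivalence class $c$ of Riemannian metrics on $M$, where $g\sim g'$ iff $g'=e^{2u}g$ for some $u\in C^\infty(M)$. $\mathcal{T}_{(1,1)}M$ denotes the endomorphism fields of $TM$ and $\mathcal{T}_{(0,2)}M$ the covariant 2-tensor fields. $\mathrm{scal}^g$ is the scalar curvature of $g$. Möbius structure. A Möbius structure for $(M,c)$ ($n=\dim M\ge 2$) is a map $D\colon c\to\mathcal{T}_{(0,2)}M$ such that (1) for every $g\in c$, $D(g)$ is symmetric and $\mathrm{trace}_gD(g)=\frac{\mathrm{scal}^g}{2(n-1)}$; (2) for every $g\in c$ and $u\in C^\infty(M)$, $D(e^{2u}g)=D(g)-\frac{\|\nabla^gu\|_g^2}{2}g-\mathrm{Hess}^g(u)+du\otimes du$, where $\nabla^g u$ is the $g$-gradient and $\mathrm{Hess}^g(u)$ the $g$-Hessian. By (2), $D$ is determined by its value at one $g\in c$; the restriction of $D$ to an open set $\mathcal{O}$ is the Möbius structure for $c|_{\mathcal{O}}=[g|_{\mathcal{O}}]$ with value $D(g)|_{\mathcal{O}}$ at $g|_{\mathcal{O}}$. Admissible family. A smooth $1$-parameter family $\alpha\colon\mathbb{R}\to\mathcal{T}_{(1,1)}M$ (with derivative $\dot\alpha(\rho)$ in $\rho$) is admissible if each $\alpha(\rho)$ is self-adjoint with respect to any $g\in c$, $\alpha(0)=\mathrm{Id}$, and there is $\delta>0$ such that $\alpha(\rho)$ is nonsingular for $|\rho|<\delta$.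 Construction (for a manifold $M$, a metric $g\in c$ and an admissible $\alpha$, with $\delta>0$ such that $\alpha(\rho)$ is nonsingular for $|\rho|<\delta$; applied in the claim with $\mathcal{O}$ in place of $M$). Let $\widetilde M=\mathbb{R}^+\times(-\delta,\delta)\times M$ with coordinates $(t,\rho)$ on the first two factors, and let $\widetilde g$ be the Lorentzian metric $$\widetilde g=d(\rho t)\otimes dt+dt\otimes d(\rho t)+t^2\,g(\alpha(\rho)(-),-).$$ For $u\in C^\infty(M)$ the immersion $\Psi^u(x)=(e^{u(x)},0,x)$ is spacelike with $(\Psi^u)^*\widetilde g=e^{2u}g$. Its lightlike normal field $\eta^u$ is $$\eta^u=e^{-u}\tfrac{\|\nabla^gu\|_g^2}{2}\,\partial_t|_{\Psi^u}-e^{-2u}\partial_\rho|_{\Psi^u}+e^{-2u}\nabla^gu|_{\Psi^u},$$ where a vector field on $M$ is identified with its natural lift to $\widetilde M$ and $X|_{\Psi^u}=X\circ\Psi^u$. The Weingarten endomorphism $A_\eta$ of a normal field $\eta$ is defined by $(\widetilde\nabla_V\eta)^\top=-T\Psi^u\cdot A_\eta V$ for $V\in\mathfrak{X}(M)$, where $\widetilde\nabla$ is (induced by) the Levi-Civita connection of $\widetilde g$ and $\top$ denotes the tangential part. *)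

(* Defs.v *)
From mathcomp Require Import all_boot all_order all_algebra.
From mathcomp Require Import all_classical all_reals all_analysis.

Set Implicit Arguments.
Unset Strict Implicit.
Unset Printing Implicit Defensive.

Import Order.TTheory GRing.Theory Num.Theory.
Import numFieldNormedType.Exports.

Local Open Scope classical_set_scope.
Local Open Scope ring_scope.

(* Tangent vectors are row vectors.  A linear map acts by V |-> V *m E, and a
   bilinear form with matrix B takes the value (V *m B *m W^T) 0 0. *)

Definition partial (R : realType) (n : nat) (k : 'I_n) (f : 'rV[R]_n -> R)
  : 'rV[R]_n -> R := fun y => 'D_(delta_mx 0 k) f y.

Fixpoint Ck (R : realType) (n k : nat) (U : set 'rV[R]_n) (f : 'rV[R]_n -> R)
  : Prop :=
  (forall y, U y -> {for y, continuous f}) /\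
  match k with
  | 0 => True
  | k'.+1 => forall a : 'I_n,
      (forall y, U y -> derivable f y (delta_mx 0 a)) /\
      Ck k' U (partial a f)
  end.

(* Only used for open U. *)
Definition Cinfty (R : realType) (n : nat) (U : set 'rV[R]_n)
  (f : 'rV[R]_n -> R) : Prop := forall k, Ck k U f.

(* A space with a family of n-dimensional charts: chart i is the map
   [coord i : dom i -> 'rV_n], with inverse [inv i].  The values of [coord i]
   off [dom i], and of [inv i] off the image of [dom i], are irrelevant. *)
Record atlas (R : realType) (n : nat) := Atlas {
  carrier :> topologicalType;
  chart : Type;
  dom : chart -> set carrier;
  coord : chart -> carrier -> 'rV[R]_n;
  inv : chart -> 'rV[R]_n -> carrier }.

Arguments chart {R n} a.
Arguments dom {R n a} _.
Arguments coord {R n a} _ _.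
Arguments inv {R n a} _ _.

Definition is_manifold (R : realType) (n : nat) (M : atlas R n) : Prop :=
  [/\ hausdorff_space M,
      @second_countable M,
      forall x : M, exists i : chart M, dom i x,
      forall i : chart M,
        [/\ open (dom i), open (coord i @` dom i),
            forall x, dom i x -> inv i (coord i x) = x,
            forall x, dom i x -> {for x, continuous (coord i)}
          & forall x, dom i x -> {for coord i x, continuous (inv i)}]
    & forall (i j : chart M) (a : 'I_n),
        Cinfty (coord i @` (dom i `&` dom j))
               (fun y => coord j (inv i y) 0 a)].

Section Fields.
Variables (R : realType) (n : nat) (M : atlas R n).
Implicit Types (O : set M) (i j : chart M) (u : M -> R).

(* the coordinate derivative d/dx^k in the chart i *)
Definition pd i (k : 'I_n) (f : M -> R) (x : M) : R :=
  partial k (f \o inv i) (coord i x).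

Definition smooth_in i O (f : M -> R) : Prop :=
  Cinfty (coord i @` (O `&` dom i)) (f \o inv i).

Definition smooth_on O u : Prop := forall i, smooth_in i O u.

(* components, in the chart i, of the differential of f *)
Definition differential (f : M -> R) i (x : M) : 'rV[R]_n :=
  \row_k pd i k f x.

(* Jacobian of the change of coordinates from i to j *)
Definition transition i j (x : M) : 'M[R]_n :=
  \matrix_(a, b) pd i a (fun y => coord j y 0 b) x.

(* Fields are given by their components in every chart.  Their values at (i, x)
   with x off [dom i], or off the open set under consideration, are junk, which
   is why fields are compared with [eq_on]. *)
Definition mxfield := chart M -> M -> 'M[R]_n.

Definition eq_on O (T T' : mxfield) : Prop :=
  forall i x, O x -> dom i x -> T i x = T' i x.

Definition is_tensor02 O (B : mxfield) : Prop :=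
  (forall i a b, smooth_in i O (fun x => B i x a b)) /\
  (forall i j x, O x -> dom i x -> dom j x ->
     B i x = transition i j x *m B j x *m (transition i j x)^T).

(* the transformation rule of a field of endomorphisms *)
Definition endo_rule O (E : mxfield) : Prop :=
  forall i j x, O x -> dom i x -> dom j x ->
    E i x *m transition i j x = transition i j x *m E j x.

Definition is_tensor11 O (E : mxfield) : Prop :=
  (forall i a b, smooth_in i O (fun x => E i x a b)) /\ endo_rule O E.

Definition symmetric_on O (B : mxfield) : Prop :=
  forall i x, O x -> dom i x -> (B i x)^T = B i x.

Definition is_riemannian O (g : mxfield) : Prop :=
  [/\ is_tensor02 O g, symmetric_on O g
    & forall i x, O x -> dom i x ->
        forall v : 'rV[R]_n, v != 0 -> 0 < (v *m g i x *m v^T) 0 0].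

(* g(E(-), -) *)
Definition lower (g E : mxfield) : mxfield := fun i x => E i x *m g i x.

(* e^{2u} g *)
Definition conformal u (g : mxfield) : mxfield :=
  fun i x => expR (2 * u x) *: g i x.

Definition conformal_class O (g0 : mxfield) : set mxfield :=
  [set g | is_riemannian O g /\
           exists u, smooth_on O u /\ eq_on O g (conformal u g0)].

Definition is_conformal_structure O (c : set mxfield) : Prop :=
  exists g0, is_riemannian O g0 /\ c = conformal_class O g0.

(* g may be any pseudo-Riemannian metric in the following four definitions;
   [christoffel g i k a b] is Gamma^k_{ab} of the Levi-Civita connection. *)
Definition christoffel (g : mxfield) i (k a b : 'I_n) (x : M) : R :=
  2^-1 * \sum_(l < n) invmx (g i x) k l *
    (pd i a (fun y => g i y b l) x + pd i b (fun y => g i y a l) x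
     - pd i l (fun y => g i y a b) x).

(* [curvature g i l k a b] is the l-th component of R(d_a, d_b) d_k, with
   R(X, Y) = [nabla_X, nabla_Y] - nabla_[X, Y]. *)
Definition curvature (g : mxfield) i (l k a b : 'I_n) (x : M) : R :=
  pd i a (christoffel g i l b k) x - pd i b (christoffel g i l a k) x
  + \sum_(m < n) (christoffel g i l a m x * christoffel g i m b k x
                  - christoffel g i l b m x * christoffel g i m a k x).

Definition ricci (g : mxfield) : mxfield := fun i x =>
  \matrix_(b, k) \sum_(a < n) curvature g i a k a b x.

Definition metric_trace (g B : mxfield) i (x : M) : R :=
  \tr (invmx (g i x) *m B i x).

Definition scal (g : mxfield) : chart M -> M -> R :=
  metric_trace g (ricci g).

Definition gradient (g : mxfield) u i (x : M) : 'rV[R]_n :=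
  differential u i x *m invmx (g i x).

(* || nabla^g u ||_g^2 *)
Definition grad_sqnorm (g : mxfield) u i (x : M) : R :=
  (gradient g u i x *m g i x *m (gradient g u i x)^T) 0 0.

Definition hessian (g : mxfield) u : mxfield := fun i x =>
  \matrix_(a, b) (pd i a (pd i b u) x
                  - \sum_(k < n) christoffel g i k a b x * pd i k u x).

(* omega (x) theta, at a point *)
Definition tensor_form (m : nat) (omega theta : 'rV[R]_m) : 'M[R]_m :=
  omega^T *m theta.

(* A Moebius structure on the open set O with conformal structure c; only the
   values of D on c matter.  The metric e^{2u} g is allowed to be represented by
   any g' equal to it on O, so that D is a function of the metric on O. *)
Definition is_mobius O (c : set mxfield) (D : mxfield -> mxfield) : Prop :=
  [/\ forall g, c g -> is_tensor02 O (D g),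
      forall g, c g -> symmetric_on O (D g) /\
        (forall i x, O x -> dom i x ->
           metric_trace g (D g) i x = scal g i x / (2 * (n%:R - 1)))
    & forall g g' u, c g -> c g' -> smooth_on O u ->
        eq_on O g' (conformal u g) ->
        eq_on O (D g') (fun i x =>
          D g i x - (grad_sqnorm g u i x / 2) *: g i x - hessian g u i x
          + tensor_form (differential u i x) (differential u i x))].

(* D' is the restriction to O of D, which is determined by its value at g. *)
Definition is_mobius_restriction (D : mxfield -> mxfield) (g : mxfield) O
  (D' : mxfield -> mxfield) : Prop :=
  is_mobius O (conformal_class O g) D' /\ eq_on O (D' g) (D g).

Definition nonsingular_below O (alpha : R -> mxfield) (delta : R) : Prop :=
  forall rho, `|rho| < delta ->
    forall i x, O x -> dom i x -> alpha rho i x \in unitmx.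

End Fields.

Arguments mxfield {R n} M.

(* R x M with the product charts id x coord i *)
Definition line_prod (R : realType) (n : nat) (M : atlas R n)
  : atlas R (1 + n) :=
  @Atlas R (1 + n) (R * M)%type (chart M)
    (fun i => [set z | dom i z.2])
    (fun i z => row_mx z.1%:M (coord i z.2))
    (fun i y => (lsubmx y 0 0, inv i (rsubmx y))).

Section Construction.
Variables (R : realType) (n : nat) (M : atlas R n).
Implicit Types (O : set M) (i : chart M) (g A : mxfield M) (u : M -> R).
Implicit Types (alpha : R -> mxfield M).

Definition is_smooth_family O alpha : Prop :=
  (forall i a b,
     @smooth_in R (1 + n) (line_prod M) i [set z | O z.2]
       (fun z => alpha z.1 i z.2 a b)) /\
  (forall rho, endo_rule O (alpha rho)).

Definition is_admissible O (c : set (mxfield M)) alpha : Prop :=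
  [/\ is_smooth_family O alpha,
      forall g rho, c g -> symmetric_on O (lower g (alpha rho)),
      eq_on O (alpha 0) (fun _ _ => 1%:M)
    & exists2 delta : R, 0 < delta & nonsingular_below O alpha delta].

(* R x R x M, whose points are written (t, (rho, x)) *)
Definition ambient : atlas R (1 + (1 + n)) := line_prod (line_prod M).

Definition ambient_dom O (delta : R) : set ambient :=
  [set z : R * (R * M) | [/\ 0 < z.1, `|z.2.1| < delta & O z.2.2]].

Definition ambient_metric g alpha : mxfield ambient := fun i z =>
  let t : ambient -> R := fun z => z.1 in
  let rho_t : ambient -> R := fun z => z.2.1 * z.1 in
  let dt := differential t i z in
  let d_rho_t := differential rho_t i z in
  tensor_form d_rho_t dt + tensor_form dt d_rho_t
  + z.1 ^+ 2 *: block_mx 0 0 0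
                  (block_mx 0 0 0 (lower g (alpha z.2.1) i z.2.2)).

Definition Psi u (x : M) : ambient := (expR (u x), (0, x)).

(* a t-component, a rho-component and a tangent vector of M *)
Definition ambient_vec (a b : R) (v : 'rV[R]_n) : 'rV[R]_(1 + (1 + n)) :=
  row_mx a%:M (row_mx b%:M v).

Definition eta g u i (x : M) : 'rV[R]_(1 + (1 + n)) :=
  (expR (- u x) * (grad_sqnorm g u i x / 2)) *: ambient_vec 1 0 0
  - expR (- 2 * u x) *: ambient_vec 0 1 0
  + expR (- 2 * u x) *: ambient_vec 0 0 (gradient g u i x).

(* Below, i denotes both a chart of M and the product chart of the ambient
   space that extends it. *)

(* v |-> TF.v, for F : M -> ambient *)
Definition tangent_map (F : M -> ambient) i (x : M) (v : 'rV[R]_n)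
  : 'rV[R]_(1 + (1 + n)) :=
  v *m \matrix_(k, a) pd i k (fun y => @coord _ _ ambient i (F y) 0 a) x.

(* the derivative at x, in the direction v, of the vector field xi along F *)
Definition cov_along (gt : mxfield ambient) (F : M -> ambient)
  (xi : chart M -> M -> 'rV[R]_(1 + (1 + n))) i (x : M) (v : 'rV[R]_n)
  : 'rV[R]_(1 + (1 + n)) :=
  \row_l (\sum_(k < n) v 0 k * pd i k (fun y => xi i y 0 l) x
          + \sum_(a < 1 + (1 + n)) \sum_(b < 1 + (1 + n))
              @christoffel _ _ ambient gt i l a b (F x)
              * tangent_map F i x v 0 a * xi i x 0 b).

Definition is_tangential_part (gt : mxfield ambient) (F : M -> ambient) i
  (x : M) (w tau : 'rV[R]_(1 + (1 + n))) : Prop :=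
  (exists v, tau = tangent_map F i x v) /\
  forall v, ((w - tau) *m gt i (F x) *m (tangent_map F i x v)^T) 0 0 = 0.

(* A is the Weingarten endomorphism of xi along F : O -> W, W open in the
   ambient space with metric gt. *)
Definition is_weingarten O (W : set ambient) (gt : mxfield ambient)
  (F : M -> ambient) (xi : chart M -> M -> 'rV[R]_(1 + (1 + n))) A : Prop :=
  [/\ forall x, O x -> W (F x),
      is_tensor11 O A
    & forall i x, O x -> dom i x -> forall v : 'rV[R]_n,
        is_tangential_part gt F i x (cov_along gt F xi i x v)
          (- tangent_map F i x (v *m A i x))].

(* On O, the family alpha is admissible and the restriction of D is given by
   the Weingarten endomorphisms of the fields eta^u. *)
Definition realized_on (D : mxfield M -> mxfield M) g alpha O : Prop :=
  is_admissible O (conformal_class O g) alpha /\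
  forall delta : R, 0 < delta -> nonsingular_below O alpha delta ->
  forall D', is_mobius_restriction D g O D' ->
  forall u, smooth_on O u ->
  exists A, is_weingarten O (ambient_dom O delta) (ambient_metric g alpha)
              (Psi u) (eta g u) A /\
            eq_on O (D' (conformal u g)) (lower (conformal u g) A).

End Construction.

(* Main.v *)
(* Along Psi^u one has rho = 0 and t = e^u, and T Psi^u . W = (e^u du(W), 0, W).
   The rho-derivative of the ambient metric there involves alpha'(0) = 2 hatD,
   which is how D(g) enters the second fundamental form.  Lowering the index of
   the Christoffel symbols of the ambient metric, and differentiating
   g(nabla u, W) = du(W) rather than nabla u itself, the inner product of
   nabla_V eta^u with T Psi^u . W turns out to be minus the value at (V, W) of
     D(g) - |nabla u|^2 g / 2 - Hess u + du (x) du,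
   which is D(e^{2u} g); as Psi^u is an isometry from e^{2u} g, the Weingarten
   endomorphism is D(e^{2u} g) with an index raised by e^{2u} g.
   The only constraint on O is thus that Id + 2 rho hatD be nonsingular on O for
   all small rho.  This holds near every point, by continuity of the determinant,
   and therefore on all of M when M is compact. *)

Require Import Defs.
From mathcomp Require Import all_boot all_order all_algebra.
From mathcomp Require Import all_classical all_reals all_analysis.
From mathcomp Require Import ring.
(* [coord] would otherwise denote the coordinates of [vector]. *)
Import Defs.
Import Order.TTheory GRing.Theory Num.Theory.
Import numFieldNormedType.Exports.
Local Open Scope classical_set_scope.
Local Open Scope ring_scope.
Set Implicit Arguments.
Unset Strict Implicit.
Unset Printing Implicit Defensive.

(** * Smooth functions on open subsets of the coordinate space *)

Section CkCalculus.
Variables (R : realType) (n : nat).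
Implicit Types (U V : set 'rV[R]_n) (f h : 'rV[R]_n -> R) (k : nat).

Lemma CkW k U V f : V `<=` U -> Ck k U f -> Ck k V f.
Proof.
move=> VU; elim: k f => [|k IH] f /= [fc fd]; split => //;
  try by move=> y /VU; exact: fc.
by move=> a; have [da Ca] := fd a; split; [move=> y /VU; exact: da|exact: IH].
Qed.

Lemma Ck_continuous k U f y : Ck k U f -> U y -> {for y, continuous f}.
Proof. by case: k => [|k] [fc _]; exact: fc. Qed.

Lemma CkSW k U f : Ck k.+1 U f -> Ck k U f.
Proof.
elim: k f => [|k IH] f [fc fd]; split => //.
by move=> a; have [da Ca] := fd a; split => //; exact: IH.
Qed.

Lemma Ck_is_derive k U f y a :
  Ck k.+1 U f -> U y -> is_derive y (delta_mx 0 a) f (partial a f y).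
Proof. by move=> [_ /(_ a)[fd _]] Uy; apply: DeriveDef => //; exact: fd. Qed.

Lemma near_eq_continuous f h (y : 'rV[R]_n) : (\near y, f y = h y) ->
  {for y, continuous f} -> {for y, continuous h}.
Proof.
move=> fh; rewrite /prop_for /continuous_at -(nbhs_singleton fh) => fc.
exact: cvg_trans (near_eq_cvg fh) fc.
Qed.

(** Openness of [U] makes [f] and [h] agree near each of its points, so their partial derivatives
    agree on [U] as well and the induction continues. This makes the junk values off a chart image
    harmless. *)
Lemma Ck_ext k U f h : open U -> {in U, f =1 h} -> Ck k U f -> Ck k U h.
Proof.
move=> oU; elim: k f h => [|k IH] f h fh [fc fd].
all: have fhn y : U y -> \near y, f y = h y by move=> Uy;
  apply: filterS (open_nbhs_nbhs (conj oU Uy)) => z Uz; apply: fh; rewrite inE.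
  by split => // y Uy; exact: near_eq_continuous (fhn _ Uy) (fc _ Uy).
split => [y Uy|a]; first exact: near_eq_continuous (fhn _ Uy) (fc _ Uy).
have [da Ca] := fd a; split => [y Uy|].
  exact: near_eq_derivable (fhn _ Uy) (da _ Uy).
apply: IH Ca => y; rewrite inE => Uy; exact: near_eq_derive (fhn _ Uy).
Qed.

(** Introduction rule for the calculus below: an explicit formula for the derivatives replaces
    [partial a f], so that each closure property follows by induction on [k]. *)
Lemma CkS_is_derive k U f (df : 'I_n -> 'rV[R]_n -> R) : open U ->
  (forall y, U y -> {for y, continuous f}) ->
  (forall a y, U y -> is_derive y (delta_mx 0 a) f (df a y)) ->
  (forall a, Ck k U (df a)) -> Ck k.+1 U f.
Proof.
move=> oU fc fd dfC; split => // a; split => [y Uy|].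
  by have [] := fd a y Uy.
apply: (Ck_ext _ _ (dfC a)) => // y; rewrite inE => Uy.
by rewrite /partial; have [_ ->] := fd a y Uy.
Qed.

Lemma Ck_cst k U (r : R) : open U -> Ck k U (fun=> r).
Proof.
move=> oU; elim: k r => [|k IH] r; first by split => // y _; exact: cst_continuous.
by apply: (@CkS_is_derive _ _ _ (fun _ _ => 0)) => // y _; exact: cst_continuous.
Qed.

Lemma CkD k U f h : open U -> Ck k U f -> Ck k U h ->
  Ck k U (fun y => f y + h y).
Proof.
move=> oU; elim: k f h => [|k IH] f h Cf Ch.
  by split => // y Uy; apply: continuousD; exact: (@Ck_continuous 0 U).
apply: (@CkS_is_derive _ _ _ (fun a y => partial a f y + partial a h y)) => //.
- by move=> y Uy; apply: continuousD; exact: (@Ck_continuous k.+1 U).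
- move=> a y Uy.
  exact: (is_deriveD (Ck_is_derive a Cf Uy) (Ck_is_derive a Ch Uy)).
- move=> a; apply: IH; first by case: Cf => _ /(_ a)[].
  by case: Ch => _ /(_ a)[].
Qed.

Lemma CkM k U f h : open U -> Ck k U f -> Ck k U h ->
  Ck k U (fun y => f y * h y).
Proof.
move=> oU; elim: k f h => [|k IH] f h Cf Ch.
  by split => // y Uy; apply: continuousM; exact: (@Ck_continuous 0 U).
apply: (@CkS_is_derive _ _ _
  (fun a y => f y * partial a h y + h y * partial a f y)) => //.
- by move=> y Uy; apply: continuousM; exact: (@Ck_continuous k.+1 U).
- move=> a y Uy.
  exact: (is_deriveM (Ck_is_derive a Cf Uy) (Ck_is_derive a Ch Uy)).
- move=> a; apply: CkD => //; apply: IH; try exact: CkSW.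
  by case: Ch => _ /(_ a)[].
  by case: Cf => _ /(_ a)[].
Qed.

(** The derivative [- f^-2 df] contains [1/f] again, but only its class C^k is called for, and this
    is the induction hypothesis. *)
Lemma CkV k U f : open U -> (forall y, U y -> f y != 0) ->
  Ck k U f -> Ck k U (fun y => (f y)^-1).
Proof.
move=> oU fn0; elim: k => [|k IH] Cf.
  by split => // y Uy; apply: continuousV; [exact: fn0|exact: (@Ck_continuous 0 U)].
apply: (@CkS_is_derive _ _ _
  (fun a y => (- 1) * ((f y)^-1 * (f y)^-1 * partial a f y))) => //.
- by move=> y Uy; apply: continuousV; [exact: fn0|exact: (@Ck_continuous k.+1 U)].
- move=> a y Uy; have [fd _] := Ck_is_derive a Cf Uy.
  apply: DeriveDef; first exact: derivableV (fn0 _ Uy) fd.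
  by rewrite (deriveV (fn0 _ Uy) fd) expr2 invfM mulN1r -[RHS]mulNr.
- move=> a; apply: CkM => //; first exact: Ck_cst.
  have Cf' := IH (CkSW Cf).
  by apply: CkM => //; [exact: CkM|case: Cf => _ /(_ a)[]].
Qed.

Lemma is_derive_expR_comp f (y v : 'rV[R]_n) (df : R) :
  is_derive y v f df -> is_derive y v (fun z => expR (f z)) (expR (f y) * df).
Proof.
move=> [fd <-].
(* Restriction to the line [t *: v + y] turns the derivative along [v] into a one-variable
   derivative at 0, where the chain rule [is_derive1_comp] applies. *)
have D1 h : is_derive (0 : R) 1 (fun t : R => h (t *: v + y)) ('D_v h y)
    <-> derivable h y v.
  split=> [[hd _]|hd]; first exact: (iffRL (derivable1P _ _ _) hd).
  apply: DeriveDef; first exact: (iffLR (derivable1P _ _ _) hd).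
  rewrite /derive; congr (lim (_ @ 0^')); apply/funext => t /=.
  by rewrite addr0 scale0r add0r [_%:A]mulr1.
have := is_derive1_comp (is_derive_expR (f (0 *: v + y))) (iffRL (D1 f) fd).
rewrite scale0r add0r => -[ed ev].
have ed' : derivable (fun z => expR (f z)) y v.
  exact: (iffRL (derivable1P _ _ _) ed).
by apply: DeriveDef => //; rewrite -ev; have [_ ->] := iffRL (D1 _) ed'.
Qed.

Lemma Ck_expR k U f : open U -> Ck k U f -> Ck k U (fun y => expR (f y)).
Proof.
move=> oU; have ec k' : Ck k' U f ->
    forall y, U y -> {for y, continuous (fun y => expR (f y))}.
  move=> Cf y Uy; apply: (@continuous_comp _ _ _ f expR).
    exact: Ck_continuous Cf Uy.
  exact: continuous_expR.
elim: k => [|k IH] Cf; first by split => //; exact: ec Cf.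
apply: (@CkS_is_derive _ _ _ (fun a y => expR (f y) * partial a f y)) => //.
- exact: ec Cf.
- by move=> a y Uy; exact: is_derive_expR_comp (Ck_is_derive a Cf Uy).
- by move=> a; apply: CkM => //; [exact: IH (CkSW Cf)|case: Cf => _ /(_ a)[]].
Qed.

Lemma CinftyW U V f : V `<=` U -> Cinfty U f -> Cinfty V f.
Proof. by move=> VU Cf k; exact: CkW (Cf k). Qed.

Lemma Cinfty_continuous U f y : Cinfty U f -> U y -> {for y, continuous f}.
Proof. by move=> /(_ 0%N); exact: Ck_continuous. Qed.

Lemma Cinfty_is_derive U f y a : Cinfty U f -> U y ->
  is_derive y (delta_mx 0 a) f (partial a f y).
Proof. by move=> /(_ 1%N); exact: Ck_is_derive. Qed.

Lemma Cinfty_ext U f h : open U -> {in U, f =1 h} -> Cinfty U f -> Cinfty U h.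
Proof. by move=> oU fh Cf k; exact: Ck_ext (Cf k). Qed.

Lemma Cinfty_partial U f a : Cinfty U f -> Cinfty U (partial a f).
Proof. by move=> Cf k; have [_ /(_ a)[]] := Cf k.+1. Qed.

Lemma Cinfty_cst U (r : R) : open U -> Cinfty U (fun=> r).
Proof. by move=> oU k; exact: Ck_cst. Qed.

Lemma CinftyD U f h : open U -> Cinfty U f -> Cinfty U h ->
  Cinfty U (fun y => f y + h y).
Proof. by move=> oU Cf Ch k; exact: CkD. Qed.

Lemma CinftyM U f h : open U -> Cinfty U f -> Cinfty U h ->
  Cinfty U (fun y => f y * h y).
Proof. by move=> oU Cf Ch k; exact: CkM. Qed.

Lemma CinftyV U f : open U -> (forall y, U y -> f y != 0) ->
  Cinfty U f -> Cinfty U (fun y => (f y)^-1).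
Proof. by move=> oU f0 Cf k; exact: CkV. Qed.

Lemma Cinfty_expR U f : open U -> Cinfty U f -> Cinfty U (fun y => expR (f y)).
Proof. by move=> oU Cf k; exact: Ck_expR. Qed.

Lemma Cinfty_sum U (I : Type) (r : seq I) (P : pred I)
    (F : I -> 'rV[R]_n -> R) : open U ->
  (forall i, Cinfty U (F i)) -> Cinfty U (fun y => \sum_(i <- r | P i) F i y).
Proof.
move=> oU CF; elim: r => [|i r IH].
  by under eq_fun do rewrite big_nil; exact: Cinfty_cst.
under eq_fun do rewrite big_cons.
by case: (P i) => //; exact: CinftyD.
Qed.

Lemma Cinfty_prod U (I : Type) (r : seq I) (P : pred I)
    (F : I -> 'rV[R]_n -> R) : open U ->
  (forall i, Cinfty U (F i)) -> Cinfty U (fun y => \prod_(i <- r | P i) F i y).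
Proof.
move=> oU CF; elim: r => [|i r IH].
  by under eq_fun do rewrite big_nil; exact: Cinfty_cst.
under eq_fun do rewrite big_cons.
by case: (P i) => //; exact: CinftyM.
Qed.

Lemma Cinfty_mulmx U p q r (F : 'rV[R]_n -> 'M[R]_(p, q))
    (G : 'rV[R]_n -> 'M[R]_(q, r)) : open U ->
  (forall a b, Cinfty U (fun y => F y a b)) ->
  (forall a b, Cinfty U (fun y => G y a b)) ->
  forall a b, Cinfty U (fun y => (F y *m G y) a b).
Proof.
move=> oU CF CG a b; under eq_fun do rewrite mxE.
by apply: Cinfty_sum => // k; exact: CinftyM.
Qed.

Lemma Cinfty_det U p (F : 'rV[R]_n -> 'M[R]_p) : open U ->
  (forall a b, Cinfty U (fun y => F y a b)) -> Cinfty U (fun y => \det (F y)).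
Proof.
move=> oU CF; apply: Cinfty_sum => // s; apply: CinftyM => //.
  exact: Cinfty_cst.
by apply: Cinfty_prod.
Qed.

Lemma Cinfty_invmx U p (F : 'rV[R]_n -> 'M[R]_p) : open U ->
  (forall y, U y -> F y \in unitmx) ->
  (forall a b, Cinfty U (fun y => F y a b)) ->
  forall a b, Cinfty U (fun y => invmx (F y) a b).
Proof.
move=> oU Fu CF a b.
(* Cramer's rule with the cofactors spelled out. [invmx] obeys it only at invertible matrices, so
   the replacement is made on [U]. *)
apply: (@Cinfty_ext _ (fun y => (\det (F y))^-1 *
    ((-1) ^+ (b + a) * \det (row' b (col' a (F y)))))) => // [y|].
  by rewrite inE => /Fu Fy; rewrite /invmx Fy !mxE.
apply: CinftyM => //.
  apply: CinftyV => //; last exact: Cinfty_det.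
  by move=> y /Fu; rewrite unitmxE unitfE.
apply: CinftyM => //; first exact: Cinfty_cst.
apply: Cinfty_det => // a' b'; under eq_fun do rewrite !mxE.
exact: CF.
Qed.

End CkCalculus.

(** * Calculus of the two projections of R^(1+n) to R and R^n *)

Section Projections.
Variables (R : realType) (n : nat).

Lemma lsubmx_delta (a : 'I_(1 + n)) :
  lsubmx (delta_mx 0 a : 'rV[R]_(1 + n)) 0 0 = (a == lshift n 0)%:R.
Proof. by rewrite !mxE eqxx /= eq_sym. Qed.

Lemma rsubmx_delta_lshift :
  rsubmx (delta_mx 0 (lshift n 0) : 'rV[R]_(1 + n)) = 0.
Proof. by apply/rowP => k; rewrite !mxE eqxx andTb eq_rlshift. Qed.

Lemma rsubmx_delta_rshift k :
  rsubmx (delta_mx 0 (rshift 1 k) : 'rV[R]_(1 + n)) = delta_mx 0 k.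
Proof. by apply/rowP => l; rewrite !mxE eqxx andTb eq_rshift. Qed.

Lemma lsubmx_continuous : continuous (fun y : 'rV[R]_(1 + n) => lsubmx y 0 0).
Proof.
move=> y; under [X in continuous_at _ X]eq_fun do rewrite mxE.
exact: coord_continuous.
Qed.

Lemma rsubmx_continuous :
  continuous (rsubmx : 'rV[R]_(1 + n) -> 'rV[R]_n).
Proof. by move=> y; exact/differentiable_continuous/differentiable_rsubmx. Qed.

(** By linearity of [rsubmx] the two difference quotients are the same function of [h], so the
    equality holds for every [f]. *)
Lemma derive_rsubmx (f : 'rV[R]_n -> R) y v :
  'D_v (fun z : 'rV[R]_(1 + n) => f (rsubmx z)) y = 'D_(rsubmx v) f (rsubmx y).
Proof.
rewrite /derive; congr (lim (_ @ 0^')); apply/funext => h /=.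
by rewrite linearP.
Qed.

Lemma derivable_rsubmx (f : 'rV[R]_n -> R) y v :
  derivable f (rsubmx y) (rsubmx v) ->
  derivable (fun z : 'rV[R]_(1 + n) => f (rsubmx z)) y v.
Proof.
rewrite /derivable => fv.
have -> : (fun h : R => h^-1 *: (((fun z : 'rV[R]_(1 + n) => f (rsubmx z))
    \o shift y) (h *: v) - f (rsubmx y))) =
    fun h => h^-1 *: ((f \o shift (rsubmx y)) (h *: rsubmx v) - f (rsubmx y)).
  by apply/funext => h /=; rewrite linearP.
exact: fv.
Qed.

Lemma derive_lsubmx y (v : 'rV[R]_(1 + n)) :
  is_derive y v (fun z => lsubmx z 0 0) (lsubmx v 0 0).
Proof.
have -> : (fun z : 'rV[R]_(1 + n) => lsubmx z 0 0) = (fun z => z 0 (lshift n 0)).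
  by apply/funext => z; rewrite mxE.
have e : (fun h : R => h^-1 *: ((h *: v + y) 0 (lshift n 0) - y 0 (lshift n 0)))
   @ 0^' --> v 0 (lshift n 0).
  (* The projection is linear, so its difference quotient is constant off [h = 0]. *)
  apply: cvg_near_cst; near=> h.
  rewrite !mxE addrK [LHS]/GRing.scale/= mulrA mulVf ?mul1r//.
  by near: h; exact: nbhs_dnbhs_neq.
apply: DeriveDef; first by apply/cvg_ex; exists (v 0 (lshift n 0)).
by rewrite mxE; apply: cvg_lim.
Unshelve. all: by end_near. Qed.

(** A pullback under the projection is constant in the first direction, and its other derivatives
    are the pullbacks of the [partial b f]; induction on [k] applies to these. *)
Lemma Ck_rsubmx k (U : set 'rV[R]_n) f : open U -> Ck k U f ->
  Ck k [set y : 'rV[R]_(1 + n) | U (rsubmx y)] (fun y => f (rsubmx y)).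
Proof.
move=> oU; have oU' : open [set y : 'rV[R]_(1 + n) | U (rsubmx y)].
  by apply: open_comp => // y _; exact: rsubmx_continuous.
have rc k' h : Ck k' U h -> forall y : 'rV[R]_(1 + n), U (rsubmx y) ->
    {for y, continuous (fun y => h (rsubmx y))}.
  move=> Ch y Uy; apply: continuous_comp; first exact: rsubmx_continuous.
  exact: Ck_continuous Ch Uy.
elim: k f => [|k IH] f Cf; first by split => //; exact: rc Cf.
split; first exact: rc Cf.
move=> a; case: (split_ordP a) => b ->.
  split => [y Uy|].
    apply: derivable_rsubmx.
    by rewrite (ord1 b) rsubmx_delta_lshift; exact: derivable0.
  apply: (@Ck_ext _ _ _ _ (fun=> 0)) => // [y _|]; last exact: Ck_cst.
  by rewrite /partial derive_rsubmx (ord1 b) rsubmx_delta_lshift derive0.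
split => [y Uy|].
  apply: derivable_rsubmx.
  by rewrite rsubmx_delta_rshift; case: Cf => _ /(_ b)[/(_ _ Uy)].
have Cb : Ck k U (partial b f) by case: Cf => _ /(_ b)[].
apply: Ck_ext (IH _ Cb) => // y _.
by rewrite /partial derive_rsubmx rsubmx_delta_rshift.
Qed.

Lemma Cinfty_rsubmx (U : set 'rV[R]_n) f : open U -> Cinfty U f ->
  Cinfty [set y : 'rV[R]_(1 + n) | U (rsubmx y)] (fun y => f (rsubmx y)).
Proof. by move=> oU Cf k; exact: Ck_rsubmx. Qed.

Lemma Cinfty_lsubmx (U : set 'rV[R]_(1 + n)) : open U ->
  Cinfty U (fun y => lsubmx y 0 0).
Proof.
move=> oU [|k]; first by split => // y _; exact: lsubmx_continuous.
apply: (@CkS_is_derive _ _ _ _ _ (fun a _ => lsubmx (delta_mx 0 a) 0 0)) => //.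
- by move=> y _; exact: lsubmx_continuous.
- by move=> a y _; exact: derive_lsubmx.
- by move=> a; exact: Ck_cst.
Qed.

End Projections.

(** * Smooth functions and metrics in a chart *)

Section Manifold.
Variables (R : realType) (n : nat) (M : atlas R n).
Hypothesis mfdM : is_manifold M.
Implicit Types (O : set M) (i j : chart M) (u f h : M -> R) (x : M).

Lemma invK i x : dom i x -> inv i (coord i x) = x.
Proof. by case: mfdM => _ _ _ /(_ i)[_ _ /(_ x)]. Qed.

Lemma coordK i O y : (coord i @` (O `&` dom i)) y -> coord i (inv i y) = y.
Proof. by move=> [x [_ ix] <-]; rewrite invK. Qed.

Lemma chart_image_inv i O y : (coord i @` (O `&` dom i)) y ->
  O (inv i y) /\ dom i (inv i y).
Proof. by move=> [x [Ox ix] <-]; rewrite invK. Qed.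

Lemma mem_chart_image i O x : O x -> dom i x ->
  (coord i @` (O `&` dom i)) (coord i x).
Proof. by move=> Ox ix; exists x. Qed.

(** Continuity of [inv i] at [coord i x] pulls the open set [O] meet [dom i] back to a
    neighbourhood. It is intersected with the open image of the chart, off which [inv i] is junk. *)
Lemma open_chart_image i O : open O -> open (coord i @` (O `&` dom i)).
Proof.
case: mfdM => _ _ _ /(_ i)[od oc _ _ ci] _ oO.
rewrite openE => _ [x [Ox ix] <-]; rewrite /interior.
have nx : nbhs (coord i x) (coord i @` dom i).
  by apply: open_nbhs_nbhs; split => //; exists x.
have nO : nbhs (inv i (coord i x)) (O `&` dom i).
  by rewrite invK//; apply: open_nbhs_nbhs; split => //; exact: openI.
have := ci x ix _ nO; rewrite nbhs_filterE => nO'.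
near=> y.
have [z iz zy] : (coord i @` dom i) y by near: y.
have := invK iz; rewrite zy => yz.
by exists z => //; rewrite -yz; near: y.
Unshelve. all: by end_near. Qed.

Lemma near_chart i O x : open O -> O x -> dom i x ->
  \forall y \near coord i x, (coord i @` (O `&` dom i)) y.
Proof.
move=> oO Ox ix; apply: open_nbhs_nbhs; split; first exact: open_chart_image.
exact: mem_chart_image.
Qed.

Lemma smooth_cst i O (r : R) : open O -> smooth_in i O (fun=> r).
Proof. by move=> oO; apply: Cinfty_cst; exact: open_chart_image. Qed.

Lemma smoothM i O f h : open O -> smooth_in i O f -> smooth_in i O h ->
  smooth_in i O (fun x => f x * h x).
Proof. by move=> oO; apply: CinftyM; exact: open_chart_image. Qed.

Lemma smooth_expR i O f : open O -> smooth_in i O f ->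
  smooth_in i O (fun x => expR (f x)).
Proof. by move=> oO; apply: Cinfty_expR; exact: open_chart_image. Qed.

Lemma smooth_mulmx i O p q r (F : M -> 'M[R]_(p, q)) (G : M -> 'M[R]_(q, r)) :
  open O -> (forall a b, smooth_in i O (fun x => F x a b)) ->
  (forall a b, smooth_in i O (fun x => G x a b)) ->
  forall a b, smooth_in i O (fun x => (F x *m G x) a b).
Proof.
move=> oO CF CG a b.
exact: (@Cinfty_mulmx _ _ _ _ _ _ (F \o inv i) (G \o inv i)
  (open_chart_image oO) CF CG a b).
Qed.

Lemma smooth_invmx i O p (F : M -> 'M[R]_p) : open O ->
  (forall x, O x -> dom i x -> F x \in unitmx) ->
  (forall a b, smooth_in i O (fun x => F x a b)) ->
  forall a b, smooth_in i O (fun x => invmx (F x) a b).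
Proof.
move=> oO Fu CF a b.
apply: (@Cinfty_invmx _ _ _ _ (F \o inv i) (open_chart_image oO) _ CF a b).
by move=> y /chart_image_inv[Oy iy]; exact: Fu.
Qed.

Lemma smoothW i O O' f : O' `<=` O -> smooth_in i O f -> smooth_in i O' f.
Proof. by move=> OO; apply: CinftyW => y [x [/OO Ox ix] <-]; exists x. Qed.

(** [pd] evaluates the partial derivative at [coord i (inv i y)], which is known to be [y] on the
    chart image; hence the passage through [Cinfty_ext]. *)
Lemma smooth_pd i O k f : open O -> smooth_in i O f -> smooth_in i O (pd i k f).
Proof.
move=> oO Cf; apply: Cinfty_ext (Cinfty_partial k Cf).
  exact: open_chart_image.
by move=> y /set_mem yi; rewrite /pd /= (coordK yi).
Qed.

Lemma pd_is_derive i O k f x : O x -> dom i x -> smooth_in i O f ->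
  is_derive (coord i x) (delta_mx 0 k) (f \o inv i) (pd i k f x).
Proof. by move=> Ox ix Cf; exact: Cinfty_is_derive Cf (mem_chart_image Ox ix). Qed.

Lemma pd_ext i O k f h x : open O -> O x -> dom i x ->
  (forall y, O y -> dom i y -> f y = h y) -> pd i k f x = pd i k h x.
Proof.
move=> oO Ox ix fh; apply: near_eq_derive.
apply: filterS (near_chart oO Ox ix) => y /chart_image_inv[Oy iy].
exact: fh.
Qed.

Lemma eq_pd i k f h x : f =1 h -> pd i k f x = pd i k h x.
Proof. by move=> /funext ->. Qed.

Lemma pd_cst i k (r : R) x : pd i k (fun=> r) x = 0.
Proof. exact: derive_cst. Qed.

Lemma pdM i O k f h x : O x -> dom i x -> smooth_in i O f -> smooth_in i O h ->
  pd i k (fun y => f y * h y) x = f x * pd i k h x + h x * pd i k f x.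
Proof.
move=> Ox ix Cf Ch.
have [_] := is_deriveM (pd_is_derive k Ox ix Cf) (pd_is_derive k Ox ix Ch).
by rewrite /= (invK ix).
Qed.

Lemma pdN i O k f x : O x -> dom i x -> smooth_in i O f ->
  pd i k (fun y => - f y) x = - pd i k f x.
Proof.
move=> Ox ix Cf.
by have [_] := is_deriveN (pd_is_derive k Ox ix Cf).
Qed.

Lemma pd_sum i O k (I : finType) (F : I -> M -> R) x : O x -> dom i x ->
  (forall a, smooth_in i O (F a)) ->
  pd i k (fun y => \sum_a F a y) x = \sum_a pd i k (F a) x.
Proof.
move=> Ox ix CF.
suff S (r : seq I) : is_derive (coord i x) (delta_mx 0 k : 'rV[R]_n)
    ((fun y => \sum_(a <- r) F a y) \o inv i) (\sum_(a <- r) pd i k (F a) x).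
  by have [_] := S (index_enum I).
elim: r => [|a r IH].
  rewrite big_nil (_ : _ \o _ = cst 0); first exact: is_derive_cst.
  by apply/funext => y /=; rewrite big_nil.
rewrite big_cons (_ : _ \o _ = (F a \o inv i) +
    ((fun y => \sum_(a <- r) F a y) \o inv i)).
  exact: is_deriveD (pd_is_derive k Ox ix (CF a)) IH.
by apply/funext => y /=; rewrite big_cons.
Qed.

Lemma pd_expR i O k f x : O x -> dom i x -> smooth_in i O f ->
  pd i k (fun y => expR (f y)) x = expR (f x) * pd i k f x.
Proof.
move=> Ox ix Cf.
have [_] := is_derive_expR_comp (pd_is_derive k Ox ix Cf).
by rewrite /= (invK ix).
Qed.

(** Read through [inv i], the map [coord i] is the identity near [coord i x], so an entry of it has
    a constant difference quotient. *)
Lemma pd_coord i k (a : 'I_n) x : dom i x ->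
  pd i k (fun y => coord i y 0 a) x = (k == a)%:R.
Proof.
move=> ix; pose f (y : 'rV[R]_n) := y 0 a.
have -> : pd i k (fun y => coord i y 0 a) x = 'D_(delta_mx 0 k) f (coord i x).
  apply: near_eq_derive.
  apply: filterS (near_chart (@openT M) I ix) => y yi.
  by rewrite /= (coordK yi).
have e : (fun h : R => h^-1 *: (f (h *: delta_mx 0 k + coord i x) - f (coord i x)))
   @ 0^' --> ((k == a)%:R : R).
  apply: cvg_near_cst; near=> h.
  rewrite /f !mxE addrK eqxx /= eq_sym [LHS]/GRing.scale/= mulrA mulVf ?mul1r//.
  by near: h; exact: nbhs_dnbhs_neq.
exact: cvg_lim e.
Unshelve. all: by end_near. Qed.

End Manifold.

(** * Christoffel symbols and the Koszul formula *)

Section Metric.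
Variables (R : realType) (n : nat) (M : atlas R n).
Implicit Types (i : chart M) (g : mxfield M) (x : M) (X Y Z : 'rV[R]_n).

(** The derivative of the component matrix of [g] along [X]. It depends on the chart; its
    occurrences in the second fundamental form cancel against those in the Hessian. *)
Definition metric_derivative g i x X : 'M[R]_n :=
  \sum_a X 0 a *: \matrix_(b, l) pd i a (fun y => g i y b l) x.

Lemma bilin_formE p q (B : 'M[R]_(p, q)) (Y : 'rV[R]_p) (Z : 'rV[R]_q) :
  (Y *m B *m Z^T) 0 0 = \sum_b \sum_a Y 0 a * B a b * Z 0 b.
Proof.
by rewrite mxE; apply: eq_bigr => b _; rewrite !mxE mulr_suml.
Qed.

Lemma metric_derivative_formE g i x X Y Z :
  (Y *m metric_derivative g i x X *m Z^T) 0 0 =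
  \sum_b \sum_a \sum_k X 0 k * Y 0 a * Z 0 b * pd i k (fun y => g i y a b) x.
Proof.
rewrite bilin_formE; apply: eq_bigr => b _; apply: eq_bigr => a _.
rewrite summxE mulr_sumr mulr_suml; apply: eq_bigr => k _.
by rewrite !mxE; ring.
Qed.

(** The Koszul formula for vectors with constant coefficients in a chart. Lowering the index cancels
    the inverse matrix inside the Christoffel symbols, so the inverse of the ambient metric never
    has to be computed. *)
Lemma christoffel_form g i x X Y Z : g i x \in unitmx -> (g i x)^T = g i x ->
  ((\row_l \sum_a \sum_b christoffel g i l a b x * X 0 a * Y 0 b)
     *m g i x *m Z^T) 0 0 =
  2^-1 * ((Y *m metric_derivative g i x X *m Z^T) 0 0
          + (X *m metric_derivative g i x Y *m Z^T) 0 0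
          - (X *m metric_derivative g i x Z *m Y^T) 0 0).
Proof.
move=> gu gs.
pose C a b l := pd i a (fun y => g i y b l) x + pd i b (fun y => g i y a l) x
     - pd i l (fun y => g i y a b) x.
have gi m k : \sum_l g i x m l * invmx (g i x) l k = (m == k)%:R.
  by have := congr1 (fun A : 'M[R]_n => A m k) (mulmxV gu); rewrite !mxE.
(* Christoffel symbols of the first kind: by symmetry of [g], the sum over [l] is a product of [g]
   with its inverse. *)
have lower m a b : \sum_l christoffel g i l a b x * g i x l m = 2^-1 * C a b m.
  rewrite /christoffel -/(C a b _).
  transitivity (2^-1 * \sum_k (\sum_l g i x m l * invmx (g i x) l k) * C a b k).
    rewrite mulr_sumr.
    under eq_bigr => l _ do rewrite -mulrA mulr_suml mulr_sumr.
    rewrite exchange_big /=; apply: eq_bigr => k _.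
    rewrite mulr_suml mulr_sumr; apply: eq_bigr => l _.
    have -> : g i x l m = g i x m l by rewrite -[in LHS]gs mxE.
    by rewrite /C; ring.
  congr (_ * _); under eq_bigr => k _ do rewrite gi.
  rewrite (bigD1 m) //= eqxx mul1r big1 ?addr0// => k km.
  by rewrite eq_sym (negPf km) mul0r.
transitivity (2^-1 * \sum_m \sum_a \sum_b X 0 a * Y 0 b * Z 0 m * C a b m).
  rewrite bilin_formE mulr_sumr; apply: eq_bigr => m _.
  transitivity (\sum_a \sum_b X 0 a * Y 0 b * Z 0 m *
      \sum_l christoffel g i l a b x * g i x l m).
    under eq_bigr => l _ do rewrite mxE 2!mulr_suml.
    rewrite exchange_big; apply: eq_bigr => a _.
    under eq_bigr => l _ do rewrite 2!mulr_suml.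
    rewrite exchange_big; apply: eq_bigr => b _.
    by rewrite mulr_sumr; apply: eq_bigr => l _; ring.
  rewrite mulr_sumr; apply: eq_bigr => a _; rewrite mulr_sumr.
  by apply: eq_bigr => b _; rewrite lower; ring.
congr (_ * _); rewrite !metric_derivative_formE.
(* The term differentiated along [Z] is reordered so that the index paired with [Z] is outermost, as
   in the two other terms. *)
have -> : \sum_b \sum_a \sum_k Z 0 k * X 0 a * Y 0 b * pd i k (fun y => g i y a b) x
   = \sum_k \sum_a \sum_b Z 0 k * X 0 a * Y 0 b * pd i k (fun y => g i y a b) x.
  under eq_bigr => b _ do rewrite exchange_big /=.
  rewrite exchange_big; apply: eq_bigr => k _.
  by rewrite exchange_big.
rewrite -sumrN -!big_split /=; apply: eq_bigr => m _.
rewrite [X in _ = X + _ + _]exchange_big -sumrN -!big_split /=.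
apply: eq_bigr => a _; rewrite -sumrN -!big_split /=.
by apply: eq_bigr => b _; rewrite /C; ring.
Qed.

End Metric.

(** * The ambient metric *)

Section AmbientAlgebra.
Variables (R : realType) (n : nat).
Implicit Types (p q a b : R) (G : 'M[R]_n) (v w : 'rV[R]_n).

(** The covector [p dt + q drho] is [d(rho t)] for [p = rho] and [q = t]. With [p], [q] and [G]
    free, the same shape also covers the directional derivatives of the ambient metric. *)
Definition ambient_form p q G : 'M[R]_(1 + (1 + n)) :=
  tensor_form (ambient_vec p q 0) (ambient_vec 1 0 0)
  + tensor_form (ambient_vec 1 0 0) (ambient_vec p q 0)
  + block_mx 0 0 0 (block_mx 0 0 0 G).

Lemma ambient_vec_dot a b v a' b' v' :
  (ambient_vec a b v *m (ambient_vec a' b' v')^T) 0 0 =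
  a * a' + b * b' + (v *m v'^T) 0 0.
Proof.
rewrite /ambient_vec !tr_row_mx !mul_row_col !tr_scalar_mx -!scalar_mxM !mxE.
by rewrite eqxx /= !mulr1n addrA.
Qed.

Lemma ambient_formE p q G a b v a' b' v' :
  (ambient_vec a b v *m ambient_form p q G *m (ambient_vec a' b' v')^T) 0 0 =
  (p * a + q * b) * a' + a * (p * a' + q * b') + (v *m G *m v'^T) 0 0.
Proof.
rewrite !mulmxDr !mulmxDl /tensor_form.
rewrite [LHS]mxE [X in X + _ = _]mxE.
have tf (x y z t : 'rV[R]_(1 + (1 + n))) :
    (x *m (y^T *m z) *m t^T) 0 0 = (x *m y^T) 0 0 * (z *m t^T) 0 0.
  by rewrite mulmxA -mulmxA [LHS]mxE big_ord1.
rewrite !tf !ambient_vec_dot ?trmx0 ?mulmx0 ?mul0mx.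
have z0 : (0 : 'M[R]_1) 0 0 = 0 by rewrite mxE.
rewrite !z0.
rewrite {1}/ambient_vec !mul_row_block !mulmx0 !addr0 !add0r.
rewrite /ambient_vec !tr_row_mx !mul_row_col !mul0mx !add0r.
by ring.
Qed.

Lemma ambient_vecK (X : 'rV[R]_(1 + (1 + n))) :
  X = ambient_vec (lsubmx X 0 0) (lsubmx (rsubmx X) 0 0) (rsubmx (rsubmx X)).
Proof. by rewrite /ambient_vec -!mx11_scalar !hsubmxK. Qed.

(** A kernel vector [(a, b, v)] is paired with the coordinate vectors of t, of rho and of [M] in
    turn, which forces [b = 0], [a = 0] and [v *m G = 0]. The case [p = 0] is the one met along
    [Psi u], where rho = 0. *)
Lemma ambient_form_unit q G : q != 0 -> G \in unitmx ->
  ambient_form 0 q G \in unitmx.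
Proof.
move=> q0 Gu; rewrite -row_free_unit; apply: inj_row_free => X.
rewrite (ambient_vecK X).
move: (lsubmx X 0 0) (lsubmx (rsubmx X) 0 0) (rsubmx (rsubmx X)) => a b v XA.
have XE a' b' v' : q * b * a' + a * (q * b') + (v *m G *m v'^T) 0 0 = 0.
  have := ambient_formE 0 q G a b v a' b' v'.
  by rewrite XA mul0mx mxE !mul0r !add0r => <-.
have b0 : b = 0.
  have := XE 1 0 0; rewrite trmx0 mulmx0 mxE mulr1 !mulr0 !addr0 => /eqP.
  by rewrite mulf_eq0 (negPf q0) => /eqP.
have a0 : a = 0.
  have := XE 0 1 0; rewrite trmx0 mulmx0 mxE mulr1 !mulr0 !addr0 add0r => /eqP.
  by rewrite mulf_eq0 (negPf q0) orbF => /eqP.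
suff -> : v = 0 by rewrite a0 b0 /ambient_vec !raddf0 !row_mx0.
rewrite -(mulmxK Gu v); suff -> : v *m G = 0 by rewrite mul0mx.
apply/rowP => k; have := XE 0 0 (delta_mx 0 k).
by rewrite !mulr0 !add0r trmx_delta -colE !mxE => ->.
Qed.

End AmbientAlgebra.

(** * Components and coordinate derivatives on the ambient space *)

Section Ambient.
Variables (R : realType) (n : nat) (M : atlas R n).
Implicit Types (O : set M) (i : chart M) (z : ambient M) (x : M).

Lemma ambient_coordE i z :
  @coord _ _ (ambient M) i z = ambient_vec z.1 z.2.1 (coord i z.2.2).
Proof. by []. Qed.

Lemma lsubmx_ambient_vec (a b : R) (v : 'rV[R]_n) :
  lsubmx (ambient_vec a b v) 0 0 = a.
Proof. by rewrite row_mxKl mxE eqxx. Qed.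

Lemma lrsubmx_ambient_vec (a b : R) (v : 'rV[R]_n) :
  lsubmx (rsubmx (ambient_vec a b v)) 0 0 = b.
Proof. by rewrite row_mxKr row_mxKl mxE eqxx. Qed.

Lemma rrsubmx_ambient_vec (a b : R) (v : 'rV[R]_n) :
  rsubmx (rsubmx (ambient_vec a b v)) = v.
Proof. by rewrite !row_mxKr. Qed.

Lemma is_derive_rho (y v : 'rV[R]_(1 + (1 + n))) :
  is_derive y v (fun y => lsubmx (rsubmx y) 0 0) (lsubmx (rsubmx v) 0 0).
Proof.
have [dd de] := derive_lsubmx (rsubmx y) (rsubmx v).
apply: DeriveDef.
  exact: (@derivable_rsubmx _ _ (fun y => lsubmx y 0 0) y v dd).
by rewrite (derive_rsubmx (fun y => lsubmx y 0 0)).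
Qed.

(** [delta_t] and [delta_rho] are the components of dt and drho, as scalar functions of the index,
    so that single entries of the ambient metric can be differentiated. *)
Definition delta_t (a : 'I_(1 + (1 + n))) : R :=
  lsubmx (delta_mx (0 : 'I_1) a) 0 0.
Definition delta_rho (a : 'I_(1 + (1 + n))) : R :=
  lsubmx (rsubmx (delta_mx (0 : 'I_1) a)) 0 0.

Lemma ambient_vec_deltaE (p q : R) a :
  (ambient_vec p q (0 : 'rV[R]_n)) 0 a = p * delta_t a + q * delta_rho a.
Proof.
rewrite /delta_t /delta_rho /ambient_vec.
case: (split_ordP a) => b ->.
  rewrite row_mxEl (ord1 b) rsubmx_delta_lshift lsubmx_delta eqxx !mxE eqxx.
  by rewrite mulr1n mulr1 mulr0 addr0.
rewrite row_mxEr rsubmx_delta_rshift lsubmx_delta eq_rlshift mulr0 add0r.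
case: (split_ordP b) => c ->.
  by rewrite row_mxEl (ord1 c) lsubmx_delta eqxx !mxE eqxx mulr1n mulr1.
by rewrite row_mxEr lsubmx_delta eq_rlshift mulr0 mxE.
Qed.

Lemma differential_t i z :
  @differential _ _ (ambient M) (fun z => z.1) i z = ambient_vec 1 0 0.
Proof.
apply/rowP => a; rewrite mxE ambient_vec_deltaE mul1r mul0r addr0.
by have [_] := derive_lsubmx (@coord _ _ (ambient M) i z) (delta_mx 0 a).
Qed.

Lemma differential_rho_t i z :
  @differential _ _ (ambient M) (fun z => z.2.1 * z.1) i z =
  ambient_vec z.2.1 z.1 0.
Proof.
apply/rowP => a; rewrite mxE ambient_vec_deltaE.
set y := @coord _ _ (ambient M) i z.
have [_] := is_deriveM (is_derive_rho y (delta_mx 0 a))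
  (derive_lsubmx y (delta_mx 0 a)).
by rewrite /y ambient_coordE lsubmx_ambient_vec lrsubmx_ambient_vec.
Qed.

Lemma ambient_metricE (g : mxfield M) alpha i z :
  ambient_metric g alpha i z =
  ambient_form z.2.1 z.1 (z.1 ^+ 2 *: lower g (alpha z.2.1) i z.2.2).
Proof.
rewrite /ambient_metric differential_t differential_rho_t /ambient_form.
by congr (_ + _); rewrite !scale_block_mx !scaler0.
Qed.

Definition block_of (G : 'M[R]_n) : 'M[R]_(1 + (1 + n)) :=
  block_mx 0 0 0 (block_mx 0 0 0 G).

Lemma block_ofE G a b : block_of G a b =
  match fintype.split a, fintype.split b with
  | inr a', inr b' => match fintype.split a', fintype.split b' with
     | inr a'', inr b'' => G a'' b''
     | _, _ => 0
     end
  | _, _ => 0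
  end.
Proof.
rewrite /block_of mxE; case: (fintype.split a) => a'; rewrite mxE;
  case: (fintype.split b) => b'; rewrite ?mxE//.
by case: (fintype.split a') => ?; rewrite mxE; case: (fintype.split b') => ?;
  rewrite ?mxE.
Qed.

Lemma block_ofD G H a b : block_of (G + H) a b = block_of G a b + block_of H a b.
Proof.
rewrite !block_ofE.
case: (fintype.split a) => ka; case: (fintype.split b) => kb; rewrite ?addr0//.
case: (fintype.split ka) => ?; case: (fintype.split kb) => ?; rewrite ?addr0//.
by rewrite mxE.
Qed.

Lemma block_ofZ c G a b : block_of (c *: G) a b = c * block_of G a b.
Proof.
rewrite !block_ofE.
case: (fintype.split a) => ka; case: (fintype.split b) => kb; rewrite ?mulr0//.
case: (fintype.split ka) => ?; case: (fintype.split kb) => ?; rewrite ?mulr0//.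
by rewrite mxE.
Qed.

Hypothesis mfdM : is_manifold M.

Lemma smooth_block_of i O (F : M -> 'M[R]_n) : open O ->
  (forall a b, smooth_in i O (fun x => F x a b)) ->
  forall a b, smooth_in i O (fun x => block_of (F x) a b).
Proof.
move=> oO CF a b; under eq_fun do rewrite block_ofE.
case: (fintype.split a) => ka; case: (fintype.split b) => kb;
  try exact: smooth_cst.
by case: (fintype.split ka) => ?; case: (fintype.split kb) => ?;
  try exact: smooth_cst; exact: CF.
Qed.

Lemma pd_block_of i k (F : M -> 'M[R]_n) x a b :
  pd i k (fun y => block_of (F y) a b) x =
  block_of (\matrix_(c, d) pd i k (fun y => F y c d) x) a b.
Proof.
under eq_fun do rewrite block_ofE; rewrite block_ofE.
case: (fintype.split a) => ka; case: (fintype.split b) => kb; rewrite ?pd_cst//.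
case: (fintype.split ka) => ?; case: (fintype.split kb) => ?; rewrite ?pd_cst//.
by rewrite mxE.
Qed.

(* The a-th partial derivative of h, seen as a function on the ambient space. *)
Definition pd_base i (h : M -> R) (a : 'I_(1 + (1 + n))) x : R :=
  'D_(rsubmx (rsubmx (delta_mx (0 : 'I_1) a))) (h \o inv i) (coord i x).

(** In the t- and rho-directions the basis vector projects to 0, where derivability is trivial; in
    the remaining directions it projects to a basis vector of the chart of [M]. *)
Lemma is_derive_base i O h a z : O z.2.2 -> dom i z.2.2 -> smooth_in i O h ->
  is_derive (@coord _ _ (ambient M) i z) (delta_mx 0 a)
    (fun y => h (inv i (rsubmx (rsubmx y)))) (pd_base i h a z.2.2).
Proof.
move=> Oz iz Ch; rewrite ambient_coordE.
set y := ambient_vec _ _ _.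
have yE : rsubmx (rsubmx y) = coord i z.2.2 by exact: rrsubmx_ambient_vec.
apply: DeriveDef; last first.
  rewrite (derive_rsubmx (fun y => h (inv i (rsubmx y)))).
  by rewrite (derive_rsubmx (h \o inv i)) yE.
apply: (derivable_rsubmx (f := fun y => h (inv i (rsubmx y)))).
apply: (derivable_rsubmx (f := h \o inv i)); rewrite yE.
case: (split_ordP a) => b ->.
  by rewrite (ord1 b) rsubmx_delta_lshift linear0; exact: derivable0.
rewrite rsubmx_delta_rshift; case: (split_ordP b) => c ->.
  by rewrite (ord1 c) rsubmx_delta_lshift; exact: derivable0.
rewrite rsubmx_delta_rshift.
by have [] := pd_is_derive c Oz iz Ch.
Qed.

Lemma sum_pd_base i h x (X : 'rV[R]_(1 + (1 + n))) :
  \sum_a X 0 a * pd_base i h a x = \sum_k rsubmx (rsubmx X) 0 k * pd i k h x.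
Proof.
rewrite /pd_base big_split_ord big_ord1 /= rsubmx_delta_lshift linear0 derive0.
rewrite mulr0 add0r big_split_ord big_ord1 /= !rsubmx_delta_rshift.
rewrite rsubmx_delta_lshift derive0 mulr0 add0r; apply: eq_bigr => k _.
by rewrite !rsubmx_delta_rshift !mxE.
Qed.

Lemma sum_delta_t (X : 'rV[R]_(1 + (1 + n))) :
  \sum_a X 0 a * delta_t a = lsubmx X 0 0.
Proof.
rewrite /delta_t big_split_ord big_ord1 /= lsubmx_delta eqxx mulr1.
by rewrite big1 ?addr0 ?mxE// => k _; rewrite lsubmx_delta eq_rlshift mulr0.
Qed.

Lemma sum_delta_rho (X : 'rV[R]_(1 + (1 + n))) :
  \sum_a X 0 a * delta_rho a = lsubmx (rsubmx X) 0 0.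
Proof.
rewrite /delta_rho big_split_ord big_ord1 /= rsubmx_delta_lshift.
rewrite [lsubmx 0 0 0]mxE [X in _ * X]mxE mulr0 add0r.
rewrite big_split_ord big_ord1 /= rsubmx_delta_rshift lsubmx_delta eqxx mulr1.
rewrite big1 ?addr0 ?mxE// => k _.
by rewrite rsubmx_delta_rshift lsubmx_delta eq_rlshift mulr0.
Qed.

End Ambient.

(** * Partial derivatives of the ambient metric *)

Section AmbientMetric.
Variables (R : realType) (n : nat) (M : atlas R n).
Hypothesis mfdM : is_manifold M.
Variables (O : set M) (g hatD : mxfield M) (i : chart M).
Hypothesis oO : open O.
Hypothesis Cg : forall a b, smooth_in i O (fun x => g i x a b).
Hypothesis Ch : forall a b, smooth_in i O (fun x => hatD i x a b).

Definition affine_family (E : mxfield M) (rho : R) : mxfield M :=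
  fun i x => 1%:M + (2 * rho) *: E i x.

Local Notation alpha := (affine_family hatD).

Lemma lower_affine_family rho x :
  lower g (alpha rho) i x = g i x + (2 * rho) *: lower g hatD i x.
Proof. by rewrite /lower /alpha mulmxDl mul1mx -scalemxAl. Qed.

Lemma tensor_formE m (omega theta : 'rV[R]_m) b l :
  tensor_form omega theta b l = omega 0 b * theta 0 l.
Proof. by rewrite mxE big_ord1 mxE. Qed.

Lemma ambient_form_entry p q (G : 'M[R]_n) b l : ambient_form p q G b l =
  (p * delta_t R b + q * delta_rho R b) * delta_t R l
  + delta_t R b * (p * delta_t R l + q * delta_rho R l) + block_of G b l.
Proof.
rewrite /ambient_form mxE [X in X + _ = _]mxE !tensor_formE.
by rewrite !ambient_vec_deltaE !mul1r !mul0r !addr0.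
Qed.

Lemma pd_ambient_metric z a b l : O z.2.2 -> dom i z.2.2 ->
  @pd _ _ (ambient M) i a (fun z => ambient_metric g alpha i z b l) z =
  (delta_rho R a * delta_t R b + delta_t R a * delta_rho R b) * delta_t R l
  + delta_t R b * (delta_rho R a * delta_t R l + delta_t R a * delta_rho R l)
  + 2 * z.1 * delta_t R a * (block_of (g i z.2.2) b l
      + 2 * z.2.1 * block_of (lower g hatD i z.2.2) b l)
  + z.1 ^+ 2 * (pd_base i (fun x => block_of (g i x) b l) a z.2.2
      + 2 * (delta_rho R a * block_of (lower g hatD i z.2.2) b l
        + z.2.1 * pd_base i (fun x => block_of (lower g hatD i x) b l) a z.2.2)).
Proof.
move=> Oz iz; set h1 := fun x => block_of (g i x) b l.
set h2 := fun x => block_of (lower g hatD i x) b l.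
(* Each entry becomes a polynomial in t, rho and two functions on [M], with [t^2] written as a
   product, so that its derivative can be assembled from the sum and product rules alone. *)
have -> : (fun z => ambient_metric g alpha i z b l) =
    fun z => (z.2.1 * delta_t R b + z.1 * delta_rho R b) * delta_t R l
     + delta_t R b * (z.2.1 * delta_t R l + z.1 * delta_rho R l)
     + z.1 * z.1 * (h1 z.2.2 + 2 * (z.2.1 * h2 z.2.2)).
  apply/funext => w; rewrite ambient_metricE ambient_form_entry.
  rewrite lower_affine_family block_ofZ block_ofD block_ofZ expr2 -/(h1 _) -/(h2 _).
  by ring.
set y := @coord _ _ (ambient M) i z.
pose dT := derive_lsubmx y (delta_mx 0 a).
pose dr := is_derive_rho y (delta_mx 0 a).
have dh1 : is_derive y (delta_mx 0 a) (fun y => h1 (inv i (rsubmx (rsubmx y))))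
   (pd_base i h1 a z.2.2).
  by apply: is_derive_base Oz iz _; exact: smooth_block_of.
have dh2 : is_derive y (delta_mx 0 a) (fun y => h2 (inv i (rsubmx (rsubmx y))))
   (pd_base i h2 a z.2.2).
  apply: is_derive_base Oz iz _; apply: smooth_block_of => //.
  exact: smooth_mulmx.
pose c r := is_derive_cst (r : R) y (delta_mx 0 a).
have [_] := is_deriveD (is_deriveD
  (is_deriveM (is_deriveD (is_deriveM dr (c (delta_t R b)))
                          (is_deriveM dT (c (delta_rho R b))))
              (c (delta_t R l)))
  (is_deriveM (c (delta_t R b))
              (is_deriveD (is_deriveM dr (c (delta_t R l)))
                          (is_deriveM dT (c (delta_rho R l))))))
  (is_deriveM (is_deriveM dT dT)
     (is_deriveD dh1 (is_deriveM (c 2) (is_deriveM dr dh2)))).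
rewrite /pd /partial -/y => ->.
have yt : lsubmx y 0 0 = z.1 by exact: lsubmx_ambient_vec.
have yr : lsubmx (rsubmx y) 0 0 = z.2.1 by exact: lrsubmx_ambient_vec.
have yx : inv i (rsubmx (rsubmx y)) = z.2.2.
  by rewrite rrsubmx_ambient_vec invK.
rewrite /= -/(delta_t R a) -/(delta_rho R a).
rewrite /GRing.add_fun /GRing.mul_fun /= !fctE yt yr yx.
rewrite /GRing.scale /= -/(h1 _) -/(h2 _).
by ring.
Qed.

End AmbientMetric.

(** * Directional derivatives of the ambient metric at rho = 0 *)

Section Weingarten.
Variables (R : realType) (n : nat) (M : atlas R n).
Hypothesis mfdM : is_manifold M.
Variables (O : set M) (g hatD : mxfield M) (i : chart M).
Hypothesis oO : open O.
Hypothesis Cg : forall a b, smooth_in i O (fun x => g i x a b).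
Hypothesis Ch : forall a b, smooth_in i O (fun x => hatD i x a b).

Local Notation alpha := (affine_family hatD).
Local Notation gt := (ambient_metric g alpha).

Lemma block_of_metric_derivative x X b l :
  block_of (metric_derivative g i x X) b l =
  \sum_k X 0 k * pd i k (fun y => block_of (g i y) b l) x.
Proof.
rewrite (big_morph (fun G => block_of G b l) (id1 := 0) (op1 := +%R)).
- by apply: eq_bigr => k _; rewrite block_ofZ pd_block_of.
- by move=> G H; rewrite block_ofD.
- by rewrite -(scale0r 0) block_ofZ mul0r.
Qed.

(** Along [X = (a, b, v)] the covector [rho dt + t drho] has derivative [b dt + a drho], and the
    block [t^2 (g + 2 rho hatD)], with the index of [hatD] lowered, is differentiated by the product
    rule. The summand with factor [2 b] is where [hatD] enters. *)
Lemma metric_derivative_ambient t x X : O x -> dom i x ->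
  @metric_derivative _ _ (ambient M) gt i (t, (0, x)) X =
  ambient_form (lsubmx (rsubmx X) 0 0) (lsubmx X 0 0)
    ((2 * t * lsubmx X 0 0) *: g i x
     + t ^+ 2 *: (metric_derivative g i x (rsubmx (rsubmx X))
                  + (2 * lsubmx (rsubmx X) 0 0) *: lower g hatD i x)).
Proof.
move=> Ox ix; apply/matrixP => b l.
rewrite ambient_form_entry block_ofD !block_ofZ block_ofD block_ofZ.
rewrite block_of_metric_derivative -(sum_pd_base i _ x X).
rewrite -(sum_delta_t X) -(sum_delta_rho X) summxE.
set h1 := fun y => block_of (g i y) b l.
set D := block_of (lower g hatD i x) b l.
(* The summands are sorted by their factor [delta_rho], [delta_t] or [pd_base], to match the three
   sums just introduced for the components of [X]. *)
transitivity (\sum_a (X 0 a * delta_rho R a *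
     (2 * (delta_t R b * delta_t R l) + 2 * t ^+ 2 * D)
   + X 0 a * delta_t R a * (delta_rho R b * delta_t R l
     + delta_t R b * delta_rho R l + 2 * t * h1 x)
   + X 0 a * pd_base i h1 a x * t ^+ 2)).
  apply: eq_bigr => a _; rewrite !mxE.
  rewrite (@pd_ambient_metric _ _ _ mfdM O g hatD i oO Cg Ch (t, (0, x)))//=.
  by rewrite -/(h1 x) -/D -/h1; ring.
rewrite !big_split /= -!mulr_suml.
by rewrite -/(h1 x) /h1; ring.
Qed.

End Weingarten.

(** * The Weingarten endomorphism of eta *)

Section Computation.
Variables (R : realType) (n : nat) (M : atlas R n).
Hypothesis mfdM : is_manifold M.
Variables (O : set M) (g hatD : mxfield M) (i : chart M) (u : M -> R) (x : M).
Hypothesis oO : open O.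
Hypothesis Cg : forall a b, smooth_in i O (fun x => g i x a b).
Hypothesis Ch : forall a b, smooth_in i O (fun x => hatD i x a b).
Hypothesis gu : forall y, O y -> dom i y -> g i y \in unitmx.
Hypothesis gs : forall y, O y -> dom i y -> (g i y)^T = g i y.
Hypothesis Cu : smooth_in i O u.
Hypotheses (Ox : O x) (ix : dom i x).
Implicit Types (v w : 'rV[R]_n).

Local Notation alpha := (affine_family hatD).
Local Notation gt := (ambient_metric g alpha).
Local Notation du v := ((v *m (differential u i x)^T) 0 0).

Lemma bilin_formC (A : 'M[R]_n) v w : A^T = A ->
  (v *m A *m w^T) 0 0 = (w *m A *m v^T) 0 0.
Proof.
move=> As; rewrite -[in RHS]As.
have -> : w *m A^T *m v^T = (v *m A *m w^T)^T by rewrite !trmx_mul trmxK mulmxA.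
by rewrite [RHS]mxE.
Qed.

Lemma tr_metric_derivative X :
  (metric_derivative g i x X)^T = metric_derivative g i x X.
Proof.
rewrite linear_sum; apply: eq_bigr => a _; rewrite linearZ /=; congr (_ *: _).
apply/matrixP => b l; rewrite !mxE; apply: pd_ext oO Ox ix _ => // y Oy iy.
by rewrite -[in LHS](gs Oy iy) mxE.
Qed.

Lemma gradient_formE v : (gradient g u i x *m g i x *m v^T) 0 0 = du v.
Proof.
rewrite /gradient mulmxKV ?gu//.
have -> : differential u i x *m v^T = (v *m (differential u i x)^T)^T.
  by rewrite trmx_mul trmxK.
by rewrite [LHS]mxE.
Qed.

Lemma differential_formE v : du v = \sum_k v 0 k * pd i k u x.
Proof. by rewrite mxE; apply: eq_bigr => k _; rewrite !mxE. Qed.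

Definition second_partials : 'M[R]_n := \matrix_(a, b) pd i a (pd i b u) x.

(** The Christoffel term of the Hessian is [du] of the vector [C] built from [v] and [w], that is,
    the inner product of [C] with the gradient; the Koszul formula then applies with the gradient as
    third argument. *)
Lemma hessian_form v w :
  (v *m hessian g u i x *m w^T) 0 0 = (v *m second_partials *m w^T) 0 0
  - 2^-1 * ((w *m metric_derivative g i x v *m (gradient g u i x)^T) 0 0
     + (v *m metric_derivative g i x w *m (gradient g u i x)^T) 0 0
     - (v *m metric_derivative g i x (gradient g u i x) *m w^T) 0 0).
Proof.
rewrite -(christoffel_form v w (gradient g u i x) (gu Ox ix) (gs Ox ix)).
set C := \row_l _.
rewrite (bilin_formC C _ (gs Ox ix)) gradient_formE differential_formE.
rewrite (_ : hessian g u i x = second_partials -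
    \matrix_(a, b) \sum_k christoffel g i k a b x * pd i k u x); last first.
  by apply/matrixP => a b; rewrite !mxE.
rewrite mulmxBr mulmxBl [LHS]mxE; congr (_ + _); rewrite [LHS]mxE; congr (- _).
rewrite bilin_formE.
transitivity (\sum_b \sum_a \sum_k
   christoffel g i k a b x * v 0 a * w 0 b * pd i k u x).
  apply: eq_bigr => b _; apply: eq_bigr => a _.
  by rewrite mxE mulr_sumr mulr_suml; apply: eq_bigr => k _; ring.
rewrite exchange_big /=.
under eq_bigr => a _ do rewrite exchange_big /=.
rewrite exchange_big /=; apply: eq_bigr => k _.
rewrite mxE mulr_suml; apply: eq_bigr => a _; rewrite mulr_suml.
by apply: eq_bigr.
Qed.

(** The Jacobian has three blocks: [e^u du] from the t-component, 0 from the constant rho-component,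
    and the identity from the chart of [M]. *)
Lemma tangent_map_Psi v :
  tangent_map (Psi u) i x v = ambient_vec (expR (u x) * du v) 0 v.
Proof.
rewrite /tangent_map; set T := \matrix_(k, a) _.
have -> : T = row_mx (expR (u x) *: (differential u i x)^T) (row_mx 0 1%:M).
  apply/matrixP => k a; rewrite mxE.
  case: (split_ordP a) => b ->.
    rewrite row_mxEl (ord1 b) !mxE -(pd_expR mfdM k Ox ix Cu).
    by apply: eq_pd => y; rewrite row_mxEl mxE eqxx mulr1n.
  rewrite row_mxEr; case: (split_ordP b) => c ->.
    rewrite row_mxEl mxE -[RHS](pd_cst i k 0 x).
    apply: eq_pd => y.
    by rewrite row_mxEr row_mxEl (ord1 c) mxE eqxx mulr1n.
  rewrite row_mxEr mxE -(pd_coord mfdM k c ix).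
  apply: eq_pd => y.
  by rewrite !row_mxEr.
rewrite !mul_mx_row mulmx0 mulmx1 -scalemxAr /ambient_vec.
by rewrite -(scale_scalar_mx _ _) -mx11_scalar raddf0.
Qed.

Let s := grad_sqnorm g u i x.
Let G := gradient g u i x.
Let E := expR (u x).

Lemma etaE y : eta g u i y =
  ambient_vec (expR (- u y) * (grad_sqnorm g u i y / 2)) (- expR (- 2 * u y))
              (expR (- 2 * u y) *: gradient g u i y).
Proof.
rewrite /eta /ambient_vec !scale_row_mx !scaler0 !scale_scalar_mx.
rewrite opp_row_mx opp_row_mx oppr0 !add_row_mx.
by rewrite !mulr1 !mulr0 !(raddf0, raddfN, oppr0, addr0, add0r) /= ?addr0 ?add0r.
Qed.

Lemma pd_expRM k (c : R) :
  pd i k (fun y => expR (c * u y)) x = c * expR (c * u x) * pd i k u x.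
Proof.
have Cc : smooth_in i O (fun=> c) by exact: smooth_cst.
rewrite (pd_expR mfdM k Ox ix (smoothM mfdM oO Cc Cu)).
by rewrite (pdM mfdM k Ox ix Cc Cu) pd_cst; ring.
Qed.

Lemma smooth_expRM (c : R) : smooth_in i O (fun y => expR (c * u y)).
Proof.
by apply: smooth_expR => //; apply: smoothM => //; exact: smooth_cst.
Qed.

Lemma smooth_gradient l : smooth_in i O (fun y => gradient g u i y 0 l).
Proof.
apply: smooth_mulmx => // a b; last exact: smooth_invmx.
by under eq_fun do rewrite mxE; exact: smooth_pd.
Qed.

Definition derivative_row v (xi : M -> 'rV[R]_n) : 'rV[R]_n :=
  \row_l \sum_k v 0 k * pd i k (fun y => xi y 0 l) x.

(** Lowering the index of the gradient gives [du], so the Leibniz rule is applied to the lowered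
    components [e^(-2u) d_m u]; this avoids differentiating the inverse metric. *)
Lemma derivative_scaled_gradient v w :
  (derivative_row v (fun y => expR (- 2 * u y) *: gradient g u i y)
     *m g i x *m w^T) 0 0 =
  expR (- 2 * u x) * (- 2 * du v * du w + (v *m second_partials *m w^T) 0 0
    - (G *m metric_derivative g i x v *m w^T) 0 0).
Proof.
pose xi y l := expR (- 2 * u y) * gradient g u i y 0 l.
have Cxi l : smooth_in i O (fun y => xi y l).
  by apply: smoothM => //; [exact: smooth_expRM|exact: smooth_gradient].
have xiE k m : \sum_l pd i k (fun y => xi y l) x * g i x l m =
    expR (- 2 * u x) * (- 2 * pd i k u x * pd i m u x + pd i k (pd i m u) x
      - \sum_l G 0 l * pd i k (fun y => g i y l m) x).
  have e : pd i k (fun y => \sum_l xi y l * g i y l m) x =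
      pd i k (fun y => expR (- 2 * u y) * pd i m u y) x.
    apply: pd_ext oO Ox ix _ => // y Oy iy.
    transitivity (expR (- 2 * u y) * (gradient g u i y *m g i y) 0 m).
      by rewrite mxE mulr_sumr; apply: eq_bigr => l _; rewrite /xi mulrA.
    by rewrite /gradient mulmxKV ?gu// mxE.
  (* Both sides are expanded by the Leibniz rule, and the equation is then solved for the sum in
     which [xi] is differentiated. *)
  move: e; rewrite (pd_sum k Ox ix) => [|l]; last exact: smoothM.
  rewrite (pdM mfdM k Ox ix (smooth_expRM _) (smooth_pd mfdM m oO Cu)) pd_expRM.
  under eq_bigr => l _ do rewrite (pdM mfdM k Ox ix (Cxi l) (Cg l m)).
  rewrite big_split /= => e.
  have -> : \sum_l pd i k (fun y => xi y l) x * g i x l m =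
      \sum_l g i x l m * pd i k (fun y => xi y l) x.
    by apply: eq_bigr => l _; rewrite mulrC.
  have -> : \sum_l G 0 l * pd i k (fun y => g i y l m) x =
      (expR (- 2 * u x))^-1 * \sum_l xi x l * pd i k (fun y => g i y l m) x.
    rewrite mulr_sumr; apply: eq_bigr => l _.
    by rewrite /xi -/G mulrA mulrA mulVf ?mul1r ?gt_eqF ?expR_gt0.
  move/(canRL (addKr _)): e => ->.
  by have := expR_gt0 (- 2 * u x) => /lt0r_neq0 e0; field.
have -> : derivative_row v (fun y => expR (- 2 * u y) *: gradient g u i y) =
    \row_l \sum_k v 0 k * pd i k (fun y => xi y l) x.
  apply/rowP => l; rewrite !mxE; apply: eq_bigr => k _.
  by congr (_ * _); apply: eq_pd => y; rewrite mxE.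
transitivity (\sum_m \sum_k v 0 k * w 0 m *
    \sum_l pd i k (fun y => xi y l) x * g i x l m).
  rewrite bilin_formE; apply: eq_bigr => m _.
  under eq_bigr => l _ do rewrite mxE 2!mulr_suml.
  rewrite exchange_big; apply: eq_bigr => k _; rewrite mulr_sumr.
  by apply: eq_bigr => l _; ring.
rewrite bilin_formE metric_derivative_formE.
have -> : - 2 * du v * du w =
    \sum_m \sum_k v 0 k * w 0 m * (- 2 * pd i k u x * pd i m u x).
  rewrite !differential_formE !mulr_sumr; apply: eq_bigr => m _; rewrite mulr_suml.
  by apply: eq_bigr => k _; ring.
have -> : \sum_b \sum_a \sum_k v 0 k * G 0 a * w 0 b * pd i k (fun y => g i y a b) x
    = \sum_b \sum_k v 0 k * w 0 b * \sum_a G 0 a * pd i k (fun y => g i y a b) x.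
  apply: eq_bigr => b _; rewrite exchange_big; apply: eq_bigr => k _.
  by rewrite mulr_sumr; apply: eq_bigr => a _; ring.
rewrite -sumrN -!big_split mulr_sumr; apply: eq_bigr => m _ /=.
rewrite -sumrN -!big_split mulr_sumr; apply: eq_bigr => k _ /=.
by rewrite xiE mxE; ring.
Qed.

Lemma ambient_metric_Psi :
  gt i (Psi u x) = ambient_form 0 E (E ^+ 2 *: g i x).
Proof. by rewrite ambient_metricE /= lower_affine_family mulr0 scale0r addr0. Qed.

(** Tangent vectors have no rho-component, and at rho = 0 the first part of the ambient metric pairs
    dt only with drho; what is left is the block [t^2 g] with [t = e^u]. *)
Lemma Psi_isometry v w :
  (tangent_map (Psi u) i x v *m gt i (Psi u x) *m (tangent_map (Psi u) i x w)^T)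
    0 0 = (v *m conformal u g i x *m w^T) 0 0.
Proof.
rewrite ambient_metric_Psi !tangent_map_Psi ambient_formE !(mul0r, mulr0, addr0).
by rewrite add0r /conformal mulrDl mul1r expRD -expr2.
Qed.

(** The covariant derivative splits into the derivative of the components of [eta], handled by
    [derivative_scaled_gradient], and a Christoffel part, handled by the Koszul formula of the
    ambient metric. There [hatD] is produced by the rho-component [- e^(-2u)] of [eta]. *)
Lemma weingarten_form v w :
  (cov_along gt (Psi u) (eta g u) i x v *m gt i (Psi u x)
     *m (tangent_map (Psi u) i x w)^T) 0 0 =
  - (v *m (lower g hatD i x - (s / 2) *: g i x - hessian g u i x
           + tensor_form (differential u i x) (differential u i x)) *m w^T) 0 0.
Proof.
have gt0 := ambient_metric_Psi.
have E0 : E != 0 by rewrite gt_eqF ?expR_gt0.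
have gtu : gt i (Psi u x) \in unitmx.
  rewrite gt0; apply: ambient_form_unit => //.
  by rewrite unitmxZ ?gu// unitfE expf_neq0.
have gts : (gt i (Psi u x))^T = gt i (Psi u x).
  rewrite gt0 /ambient_form /tensor_form !linearD /= !trmx_mul !trmxK.
  rewrite !tr_block_mx !trmx0 linearZ /= gs//.
  by congr (_ + _); rewrite addrC.
pose Vxi : 'rV[R]_(1 + (1 + n)) :=
  \row_l \sum_k v 0 k * pd i k (fun y => eta g u i y 0 l) x.
pose Gxi : 'rV[R]_(1 + (1 + n)) := \row_l \sum_a \sum_b
  @christoffel _ _ (ambient M) gt i l a b (Psi u x)
    * tangent_map (Psi u) i x v 0 a * eta g u i x 0 b.
have -> : cov_along gt (Psi u) (eta g u) i x v = Vxi + Gxi.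
  by apply/rowP => l; rewrite !mxE.
rewrite !mulmxDl [LHS]mxE.
rewrite (@christoffel_form _ _ (ambient M) gt i (Psi u x)
  (tangent_map (Psi u) i x v) (eta g u i x) (tangent_map (Psi u) i x w) gtu gts).
rewrite !(metric_derivative_ambient mfdM oO Cg Ch (expR (u x)) _ Ox ix).
rewrite !tangent_map_Psi etaE.
rewrite !lsubmx_ambient_vec !lrsubmx_ambient_vec !rrsubmx_ambient_vec.
rewrite gt0.
rewrite {1}(ambient_vecK Vxi).
rewrite [X in X + _]ambient_formE.
rewrite [X in _ * (X + _ - _)]ambient_formE.
rewrite [X in _ * (_ + X - _)]ambient_formE.
rewrite [X in _ * (_ - X)]ambient_formE.

(* Only the [M]- and rho-components of [Vxi] are computed. The t-component is paired with the
   vanishing rho-component of the tangent vector, so the derivative of the squared norm of the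
   gradient never appears. *)
have -> : rsubmx (rsubmx Vxi) =
    derivative_row v (fun y => expR (- 2 * u y) *: gradient g u i y).
  apply/rowP => l; rewrite !mxE; apply: eq_bigr => k _.
  by congr (_ * _); apply: eq_pd => y; rewrite etaE !row_mxEr.
have -> : lsubmx (rsubmx Vxi) 0 0 = 2 * expR (- 2 * u x) * du v.
  rewrite 3!mxE differential_formE mulr_sumr; apply: eq_bigr => k _.
  transitivity (v 0 k * pd i k (fun y => - expR (- 2 * u y)) x).
    congr (_ * _); apply: eq_pd => y.
    by rewrite etaE row_mxEr row_mxEl mxE eqxx mulr1n.
  by rewrite (pdN k Ox ix (smooth_expRM _)) pd_expRM; ring.
have eN : expR (- u x) = E^-1 by rewrite expRN.
have e2 : expR (- 2 * u x) = E^-1 * E^-1.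
  by rewrite mulNr expRN mulrDl mul1r expRD invfM.
have ZE (c : R) (A : 'M[R]_n) y z : (y *m (c *: A) *m z^T) 0 0 =
    c * (y *m A *m z^T) 0 0.
  by rewrite -scalemxAr -scalemxAl mxE.
have ZEl (c : R) (A : 'M[R]_n) y z : ((c *: y) *m A *m z^T) 0 0 =
    c * (y *m A *m z^T) 0 0.
  by rewrite -!scalemxAl mxE.
have ZEr (c : R) (A : 'M[R]_n) y z : (y *m A *m (c *: z)^T) 0 0 =
    c * (y *m A *m z^T) 0 0.
  by rewrite linearZ /= -scalemxAr mxE.
have DE (A B : 'M[R]_n) y z : (y *m (A + B) *m z^T) 0 0 =
    (y *m A *m z^T) 0 0 + (y *m B *m z^T) 0 0.
  by rewrite mulmxDr mulmxDl mxE.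
have NE (A : 'M[R]_n) y z : (y *m (- A) *m z^T) 0 0 = - (y *m A *m z^T) 0 0.
  by rewrite mulmxN mulNmx mxE.
have MZ c X : metric_derivative g i x (c *: X) = c *: metric_derivative g i x X.
  rewrite /metric_derivative scaler_sumr; apply: eq_bigr => a _.
  by rewrite mxE scalerA.
rewrite MZ !(ZE, DE, NE, ZEl, ZEr) derivative_scaled_gradient hessian_form.
have -> : (v *m tensor_form (differential u i x) (differential u i x) *m w^T) 0 0
    = du v * du w.
  rewrite /tensor_form !mulmxA -mulmxA mxE big_ord1; congr (_ * _).
  by rewrite -gradient_formE /gradient mulmxKV ?gu.
(* Symmetric forms are brought to one order of arguments, so that terms meant to cancel are
   abstracted to the same variable. *)
rewrite -!/G !gradient_formE (bilin_formC v G (gs Ox ix)) !gradient_formE.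
rewrite (bilin_formC _ G (tr_metric_derivative v)).
rewrite (bilin_formC _ G (tr_metric_derivative w)).
rewrite -/s eN e2 -/E.
(* What remains is an identity of rational functions in the nonzero scalar [e = e^u] and in
   independent scalars; [l] is the t-component left uncomputed. *)
move: E E0 s (lsubmx Vxi 0 0) (du v) (du w) => e e0 s' l dv dw.
move: ((v *m lower g hatD i x *m w^T) 0 0) ((v *m second_partials *m w^T) 0 0)
  ((G *m metric_derivative g i x v *m w^T) 0 0)
  ((G *m metric_derivative g i x w *m v^T) 0 0)
  ((v *m metric_derivative g i x G *m w^T) 0 0)
  ((G *m lower g hatD i x *m w^T) 0 0) ((v *m lower g hatD i x *m G^T) 0 0)
  ((v *m g i x *m w^T) 0 0) => c1 c2 c3 c4 c5 c6 c7 c8.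
by field.
Qed.

End Computation.

(** * Admissibility and nonsingularity of Id + 2 rho E *)

Section Fields.
Variables (R : realType) (n : nat) (M : atlas R n).
Implicit Types (O : set M) (g E : mxfield M) (i j : chart M) (x : M).

Lemma posdef_unitmx (A : 'M[R]_n) :
  (forall v : 'rV[R]_n, v != 0 -> 0 < (v *m A *m v^T) 0 0) -> A \in unitmx.
Proof.
move=> Apos; rewrite -row_free_unit; apply: inj_row_free => v vA.
apply/eqP/contraT => /Apos.
by rewrite vA mul0mx mxE ltxx.
Qed.

Lemma riemannian_unitmx O g i x :
  is_riemannian O g -> O x -> dom i x -> g i x \in unitmx.
Proof. by move=> [_ _ gpos] Ox ix; apply: posdef_unitmx; exact: gpos. Qed.

(* As g_i = T g_j T^T for the transition matrix T, no chain rule is needed. *)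
Lemma transition_unitmx O g i j x : is_riemannian O g -> O x ->
  dom i x -> dom j x -> transition i j x \in unitmx.
Proof.
move=> rg Ox ix jx; have := riemannian_unitmx rg Ox ix.
have [[_ gT] _ _] := rg.
by rewrite (gT i j x)// !unitmx_mul => /andP[/andP[]].
Qed.

Lemma is_riemannianW O O' g :
  O' `<=` O -> is_riemannian O g -> is_riemannian O' g.
Proof.
move=> OO [[Cg gt] gs gpos]; split; first split.
- by move=> i a b; exact: smoothW (Cg i a b).
- by move=> i j x /OO; exact: gt.
- by move=> i x /OO; exact: gs.
- by move=> i x /OO; exact: gpos.
Qed.

Hypothesis mfdM : is_manifold M.

Lemma conformal_riemannian O g u : open O -> smooth_on O u ->
  is_riemannian O g -> is_riemannian O (conformal u g).
Proof.
move=> oO Cu [[Cg gt] gs gpos]; split; first split.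
- move=> i a b; under eq_fun do rewrite mxE.
  by apply: smoothM => //; apply: smooth_expRM.
- move=> i j x Ox ix jx; rewrite /conformal (gt i j)//.
  by rewrite -scalemxAr -scalemxAl.
- by move=> i x Ox ix; rewrite /conformal linearZ /= gs.
- move=> i x Ox ix v v0; rewrite -scalemxAr -scalemxAl mxE.
  by rewrite mulr_gt0 ?expR_gt0 ?gpos.
Qed.

Lemma mem_conformal_class O g : open O -> is_riemannian O g ->
  conformal_class O g g.
Proof.
move=> oO rg; split => //; exists (fun=> 0); split.
  by move=> i; exact: smooth_cst.
by move=> i x _ _; rewrite /conformal mulr0 expR0 scale1r.
Qed.

Lemma endo_rule_affine O E rho :
  endo_rule O E -> endo_rule O (affine_family E rho).
Proof.
move=> eE i j x Ox ix jx; rewrite /affine_family mulmxDl mulmxDr mul1mx mulmx1.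
by rewrite -scalemxAl -scalemxAr (eE i j).
Qed.

Let line_prod_image i O : set 'rV[R]_(1 + n) :=
  @coord _ _ (line_prod M) i @`
    ([set z : (R * M)%type | O z.2] `&` @dom _ _ (line_prod M) i).

Lemma line_prod_chart_image O i :
  line_prod_image i O =
  [set y | (coord i @` (O `&` dom i)) (rsubmx y)].
Proof.
apply/seteqP; split=> [_ [z [Oz iz] <-]|y [x [Ox ix] xy]] /=.
  by rewrite row_mxKr; exists z.2.
exists (lsubmx y 0 0, x) => //=.
by rewrite xy -mx11_scalar hsubmxK.
Qed.

Lemma open_line_prod_chart_image O i : open O ->
  open (line_prod_image i O).
Proof.
move=> oO; rewrite line_prod_chart_image; apply: open_comp.
  by move=> y _; exact: rsubmx_continuous.
exact: open_chart_image.
Qed.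

(** The entries are affine in rho with coefficients pulled back from [M], hence smooth jointly in
    rho and the point. *)
Lemma smooth_family_affine O E : open O -> is_tensor11 O E ->
  is_smooth_family O (affine_family E).
Proof.
move=> oO [CE eE]; split=> [i a b|rho]; last exact: endo_rule_affine.
have oU := open_line_prod_chart_image (i := i) oO.
rewrite /smooth_in -/(line_prod_image i O).
rewrite (_ : _ \o _ = (fun y : 'rV[R]_(1 + n) => (1%:M : 'M[R]_n) a b +
   2 * lsubmx y 0 0 * (fun x => E i x a b) (inv i (rsubmx y)))); last first.
  by apply/funext => y; rewrite /= /affine_family !mxE.
apply: CinftyD => //; first exact: Cinfty_cst.
apply: CinftyM => //; last first.
  rewrite line_prod_chart_image.
  apply: (Cinfty_rsubmx (f := (fun x => E i x a b) \o inv i)) => //.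
    exact: open_chart_image.
  exact: CE.
by apply: CinftyM => //; [exact: Cinfty_cst|exact: Cinfty_lsubmx].
Qed.

(** In the product chart the determinant is a continuous function with value 1 at [(0, x)]. The rest
    transfers the resulting neighbourhood from coordinates to the product filter on points and
    parameters. *)
Lemma near_affine_unitmx E i x : is_tensor11 setT E -> dom i x ->
  \forall x' \near x & rho \near (0 : R),
    affine_family E rho i x' \in unitmx.
Proof.
move=> tE ix; have [CE _] := smooth_family_affine (@openT M) tE.
pose y0 : 'rV[R]_(1 + n) := row_mx 0%:M (coord i x).
pose f (y : 'rV[R]_(1 + n)) :=
  \det (affine_family E (lsubmx y 0 0) i (inv i (rsubmx y))).
have fc : {for y0, continuous f}.
  apply: (@Cinfty_continuous _ _
    (line_prod_image i setT)).
    apply: Cinfty_det; first exact: open_line_prod_chart_image openT.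
    by move=> a b; exact: CE.
  by exists (0, x).
have f0 : f y0 != 0.
  rewrite /f /y0 row_mxKl row_mxKr /affine_family mxE eqxx mulr1n mulr0 scale0r.
  by rewrite addr0 det1 oner_eq0.
have nf : \forall y \near y0, f y != 0 by exact: cvgr_neq0 fc f0.
have [_ _ _ /(_ i)[di _ _ cc _] _] := mfdM.
(* Neighbourhoods of a row vector are given entrywise: [B 0 j] is a neighbourhood of the j-th entry.
   Entry 0 constrains rho, the others constrain the point, and finitely many such conditions hold
   together. *)
have [B Bn sB] := nf.
have nB : \forall x' \near x & rho \near (0 : R),
    forall j : 'I_(1 + n), B 0 j (row_mx rho%:M (coord i x') 0 j).
  suff H (j : 'I_(1 + n)) : filter_prod (nbhs x) (nbhs (0 : R))
      (fun p => B 0 j (row_mx p.2%:M (coord i p.1) 0 j)).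
    exact: filter_forall H.
  have := Bn 0 j.
  rewrite /y0; case: (split_ordP j) => k ->.
    rewrite row_mxEl (ord1 k) mxE eqxx mulr1n => B0.
    exists (setT, B 0 (lshift n 0)); first by split => //; exact: filterT.
    by move=> [x' rho] /= [_ Br]; rewrite row_mxEl mxE eqxx mulr1n.
  rewrite row_mxEr => Bk.
  exists ((fun x' => B 0 (rshift 1 k) (coord i x' 0 k)), setT).
    split; last exact: filterT.
    have ck : {for x, continuous (fun x' => coord i x' 0 k)}.
      apply: (@continuous_comp _ _ _ (coord i) (fun y : 'rV[R]_n => y 0 k)).
        exact: cc.
      exact: coord_continuous.
    exact: ck _ Bk.
  by move=> [x' rho] /= [Br _]; rewrite row_mxEr.
have nd : \forall x' \near x & rho \near (0 : R), dom i x'.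
  exists (dom i, setT) => [|[x' rho] []//].
  by split; [exact: open_nbhs_nbhs|exact: filterT].
apply: filterS2 nB nd => -[x' rho] /= Bx dx.
have : f (row_mx rho%:M (coord i x')) != 0.
  by apply: sB => a j; rewrite (ord1 a).
rewrite /f row_mxKl row_mxKr mxE eqxx mulr1n invK//.
by rewrite unitmxE unitfE.
Qed.

(** Matrices of an endomorphism in two charts are conjugate under the invertible transition matrix,
    so nonsingularity in one chart around [x] gives it in all charts. *)
Lemma near_affine_unitmx_charts g E x :
  is_riemannian setT g -> is_tensor11 setT E ->
  \forall x' \near x & rho \near (0 : R), forall i, dom i x' ->
    affine_family E rho i x' \in unitmx.
Proof.
move=> rg tE; have [_ _ /(_ x)[i ix] /(_ i)[di _ _ _ _] _] := mfdM.
have nd : filter_prod (nbhs x) (nbhs (0 : R)) (fun p => dom i p.1).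
  exists (dom i, setT) => [|[x' rho] []//].
  by split; [exact: open_nbhs_nbhs|exact: filterT].
apply: filterS2 (near_affine_unitmx tE ix) nd => -[x' rho] /= au ix' j jx'.
have := endo_rule_affine rho tE.2 (i := j) (j := i) I jx' ix'.
have Tu := transition_unitmx rg (i := j) (j := i) I jx' ix'.
move=> e; have : transition j i x' *m affine_family E rho i x' \in unitmx.
  by rewrite unitmx_mul Tu.
by rewrite -e unitmx_mul => /andP[].
Qed.

Lemma exists_nonsingular_below O E :
  (\forall rho \near (0 : R), forall x, O x -> forall i, dom i x ->
    affine_family E rho i x \in unitmx) ->
  exists2 delta : R, 0 < delta & nonsingular_below O (affine_family E) delta.
Proof.
move=> /nbhs_ballP[d d0 dE]; exists d => // rho rd i x Ox ix.
by apply: dE => //; rewrite /ball /= sub0r normrN.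
Qed.

(** [Id] and [E] are both self-adjoint for [g], hence so is their combination; for another metric of
    the class the bilinear form is only multiplied by [e^(2u)]. *)
Lemma affine_admissible O g E : open O -> is_riemannian O g ->
  is_tensor11 O E -> symmetric_on O (lower g E) ->
  (exists2 delta : R, 0 < delta & nonsingular_below O (affine_family E) delta) ->
  is_admissible O (conformal_class O g) (affine_family E).
Proof.
move=> oO [_ gs _] tE sE ns; split => //.
- exact: smooth_family_affine.
- move=> g' rho [_ [u [_ g'E]]] i x Ox ix.
  have gEs : E i x *m g i x = g i x *m (E i x)^T.
    by rewrite -[LHS](sE i x Ox ix) /lower trmx_mul gs.
  rewrite /lower /affine_family (g'E i x)// /conformal -scalemxAr linearZ /=.
  congr (_ *: _); rewrite mulmxDl mul1mx -scalemxAl linearD linearZ /= gs//.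
  by rewrite sE.
- by move=> i x Ox ix; rewrite /affine_family mulr0 scale0r addr0.
Qed.

Lemma realized_on_open D g E O : open O -> is_riemannian O g ->
  is_tensor11 O E -> symmetric_on O (lower g E) -> eq_on O (D g) (lower g E) ->
  (exists2 delta : R, 0 < delta & nonsingular_below O (affine_family E) delta) ->
  realized_on D g (affine_family E) O.
Proof.
move=> oO rg tE sE DE ns; split; first exact: affine_admissible.
move=> delta d0 _ D' [[D'tensor _ D'rule] D'g] u Cu.
have cg := mem_conformal_class oO rg.
have rug := conformal_riemannian oO Cu rg.
have cug : conformal_class O g (conformal u g) by split => //; exists u.
have [CB BT] := D'tensor _ cug.
have [[Cug ugT] _ _] := rug.
have [[Cg gT] gs _] := rg.
(* The candidate is the bilinear form [D' (conformal u g)] with an index raised by the metric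
   [conformal u g]. *)
pose A : mxfield M := fun i x =>
  D' (conformal u g) i x *m invmx (conformal u g i x).
have uu i x : O x -> dom i x -> conformal u g i x \in unitmx.
  exact: riemannian_unitmx.
have AE : eq_on O (D' (conformal u g)) (lower (conformal u g) A).
  by move=> i x Ox ix; rewrite /lower /A mulmxKV ?uu.
exists A; split => //; split.
- by move=> x Ox; split => //=; rewrite ?expR_gt0 ?normr0.
- split.
    move=> i; apply: (smooth_mulmx mfdM (F := D' (conformal u g) i)
      (G := fun x => invmx (conformal u g i x)) oO (CB i)).
    apply: smooth_invmx => //; exact: uu.
  move=> i j x Ox ix jx; set T := transition i j x.
  (* Multiplying the endomorphism rule on the right by this invertible matrix turns both sides into
     [D' (conformal u g) i x], by the tensor rules of the metric and of [D']. *)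
  have Xu : conformal u g j x *m T^T \in unitmx.
    by rewrite unitmx_mul uu// unitmx_tr (transition_unitmx rg).
  rewrite -[LHS](mulmxK Xu) -[RHS](mulmxK Xu); congr (_ *m _).
  transitivity (D' (conformal u g) i x).
    by rewrite -mulmxA [T *m _]mulmxA -(ugT i j x)// mulmxKV ?uu.
  by rewrite (BT i j x)// -/T /A !mulmxA mulmxKV ?uu.
- move=> i x Ox ix v; split.
    by exists (- (v *m A i x)); rewrite /tangent_map mulNmx.
  (* By [Psi_isometry] the term with [A] contributes [D' (conformal u g)] at [(v, w)]. The
     transformation rule, together with [D' g = D g = lower g E] on [O], makes it the opposite of
     the value in [weingarten_form]. *)
  move=> w; rewrite opprK !mulmxDl mxE.
  rewrite (Psi_isometry mfdM g E (Cu i) Ox ix).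
  rewrite (weingarten_form mfdM oO (Cg i) (tE.1 i) _ _ (Cu i) Ox ix).
  - rewrite /A mulmxA mulmxKV ?uu// (D'rule g _ u cg cug Cu)// D'g// DE//.
    by rewrite addNr.
  - by move=> y Oy iy; exact: riemannian_unitmx rg Oy iy.
  - by move=> y Oy iy; exact: gs.
Qed.

End Fields.

(** * The local statement and the compact case *)

Theorem mainTheorem2 (R : realType) (n : nat) (n_ge2 : (2 <= n)%N)
  (M : atlas R n) (mfdM : is_manifold M)
  (c : set (mxfield M)) (confc : is_conformal_structure setT c)
  (D : mxfield M -> mxfield M) (mobD : is_mobius setT c D)
  (g : mxfield M) (cg : c g)
  (hatD : mxfield M) (tensor_hatD : is_tensor11 setT hatD)
  (hatDE : eq_on setT (D g) (lower g hatD)) :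
  let alpha : R -> mxfield M :=
    fun rho i x => 1%:M + (2 * rho) *: hatD i x in
  (forall x : M, exists O : set M,
     [/\ open O, O x & realized_on D g alpha O]) /\
  (compact [set: M] -> realized_on D g alpha setT).
Proof.
rewrite /=; have rg : is_riemannian setT g.
  by have [g0 [_ cE]] := confc; move: cg; rewrite cE => -[].
have sE : symmetric_on setT (lower g hatD).
  move=> i x _ ix; have [_ /(_ _ cg)[+ _] _] := mobD.
  by move=> /(_ i x I ix); rewrite hatDE.
have sub (O : set M) : O `<=` setT by [].
(* Both cases reduce to finding one neighbourhood of rho = 0 that serves all points of [O] at
   once. *)
have realized O : open O -> (\forall rho \near (0 : R), forall x, O x ->
    forall i, dom i x -> affine_family hatD rho i x \in unitmx) ->
    realized_on D g (affine_family hatD) O.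
  move=> oO ns; apply: realized_on_open => //.
  - exact: is_riemannianW (sub O) rg.
  - split=> [i a b|i j x _]; first exact: smoothW (sub O) (tensor_hatD.1 i a b).
    exact: tensor_hatD.2.
  - by move=> i x _; exact: sE.
  - by move=> i x _; exact: hatDE.
  - exact: exists_nonsingular_below.
split=> [x|cptM].
  (* A product neighbourhood: the interior of [A] serves as [O], and [B] is the uniform range of rho
     over it. *)
  have [[A B] [xA B0] AB] := near_affine_unitmx_charts mfdM x rg tensor_hatD.
  exists (interior A); split; [exact: open_interior|exact: xA|].
  apply: realized; first exact: open_interior.
  apply: filterS B0 => rho Brho y /interior_subset Ay i iy.
  exact: (AB (y, rho)).
apply: realized; first exact: openT.
(* The range of rho found near each point varies with the point; compactness, in its near-covering
   form, makes it uniform over [M]. *)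
have /compact_near_coveringP cover := cptM.
have := cover R (nbhs (0 : R))
  (fun rho x => forall i, dom i x -> affine_family hatD rho i x \in unitmx) _.
apply=> x Hx.
exact (near_affine_unitmx_charts mfdM x rg tensor_hatD).
Qed.
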